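(* Let $E$ and $F$ be directed graphs, with boundary path spaces $\partial E$, $\partial F$ and graph groupoids $\mathcal{G}_E$, $\mathcal{G}_F$. (1) If $\phi:\mathcal{G}_E\to\mathcal{G}_F$ is an isomorphism, then the homeomorphism $h:\partial E\to\partial F$ induced by $\phi$ is an orbit equivalence that preserves isolated eventually periodic points. (2) Conversely, if $h:\partial E\to\partial F$ is an orbit equivalence that preserves isolated eventually periodic points, then there is an isomorphism $\phi:\mathcal{G}_E\to\mathcal{G}_F$ that induces $h$. Thus, $\mathcal{G}_E$ and $\mathcal{G}_F$ are isomorphic if and only if there is an orbit equivalence $h:\partial E\to\partial F$ that preserves isolated eventually periodic points.
   Context: $\mathbb{N}$ denotes the nonnegative integers (so $0\in\mathbb{N}$). **Graphs and paths.** A directed graph $E=(E^0,E^1,r,s)$ consists of countable sets $E^0$ (vertices), $E^1$ (edges) and functions $r,s:E^1\to E^0$ (range and source). A path of length $n\ge 1$ is a sequence $\mu=\mu_1\cdots\mu_n$ of edges with $r(\mu_i)=s(\mu_{i+1})$ for $1\le i\le n-1$; $s(\mu):=s(\mu_1)$, $r(\mu):=r(\mu_n)$, $|\mu|=n$. Vertices are paths of length $0$ with $s(v)=r(v)=v$. $E^n$ is the set of paths of length $n$, $E^*=\bigcup_{n\in\mathbb{N}}E^n$, and $E^\infty$ is the set of infinite paths $x=x_1x_2\cdots$ ($x_i\in E^1$, $r(x_i)=s(x_{i+1})$), with $s(x)=s(x_1)$ and $|x|=\infty$. For a vertex $v$, $vE^1=\{e\in E^1:s(e)=v\}$. A vertex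 $v$ is a sink if $vE^1=\emptyset$ and an infinite emitter if $vE^1$ is infinite; $E^0_{\mathrm{sing}}$ is the set of sinks and infinite emitters. **Boundary path space.** $\partial E:=E^\infty\cup\{\mu\in E^*:r(\mu)\in E^0_{\mathrm{sing}}\}$. For $\mu\in E^*$, $Z(\mu):=\{\mu x\in\partial E: x\in\partial E,\ s(x)=r(\mu)\}$ (concatenation, with $\mu x=x$ if $\mu$ is a vertex, and $\mu x=\mu$ if $x=r(\mu)$ is a vertex), and for a finite set $F\subseteq r(\mu)E^1$, $Z(\mu\setminus F):=Z(\mu)\setminus\bigcup_{e\in F}Z(\mu e)$. The sets $Z(\mu\setminus F)$ are a basis for a locally compact Hausdorff topology on $\partial E$, and each is compact and open. **Shift.** For $n\in\mathbb{N}$, $\partial E^{\ge n}:=\{x\in\partial E:|x|\ge n\}$, an open subset. The shift map $\sigma_E:\partial E^{\ge1}\to\partial E$ is $\sigma_E(x_1x_2x_3\cdots)=x_2x_3\cdots$ for $x_1x_2x_3\cdots\in\partial E^{\ge2}$ and $\sigma_E(e)=r(e)$ for $e\in\partial E\cap E^1$. $\sigma_E^n$ is the $n$-fold composition, $\sigma_E^0=\mathrm{id}$; writing $\sigma_E^n(x)$ implicitly asserts $x\in\partial E^{\ge n}$. An infinite path $x\in E^\infty$ is eventually periodic if there are $n,p\in\mathbb{N}$ with $p>0$ and $\sigma_E^{n+p}(x)=\sigma_E^n(x)$. An isolated eventually periodic point of $\partial E$ is an eventually periodic infinite path $x$ such that $\{x\}$ is open in $\partial E$. **Orbit equivalence.**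 A homeomorphism $h:\partial E\to\partial F$ is an orbit equivalence if there are continuous functions $k,l:\partial E^{\ge1}\to\mathbb{N}$ and $k',l':\partial F^{\ge1}\to\mathbb{N}$ such that $\sigma_F^{k(x)}(h(\sigma_E(x)))=\sigma_F^{l(x)}(h(x))$ for all $x\in\partial E^{\ge1}$ and $\sigma_E^{k'(y)}(h^{-1}(\sigma_F(y)))=\sigma_E^{l'(y)}(h^{-1}(y))$ for all $y\in\partial F^{\ge1}$. A homeomorphism $h:\partial E\to\partial F$ preserves isolated eventually periodic points if it maps the set of isolated eventually periodic points of $\partial E$ onto the set of isolated eventually periodic points of $\partial F$. **Graph groupoid.** $\mathcal{G}_E=\{(x,m-n,y):x,y\in\partial E,\ m,n\in\mathbb{N},\ \sigma_E^m(x)=\sigma_E^n(y)\}$, with product $(x,k,y)(w,l,z)=(x,k+l,z)$ if $y=w$ (undefined otherwise) and inverse $(x,k,y)^{-1}=(y,-k,x)$. Its topology is generated by the sets $Z(U,m,n,V):=\{(x,k,y)\in\mathcal{G}_E:x\in U,\ k=m-n,\ y\in V,\ \sigma_E^m(x)=\sigma_E^n(y)\}$, where $m,n\in\mathbb{N}$, $U\subseteq\partial E^{\ge m}$ is open with $\sigma_E^m|_U$ injective, $V\subseteq\partial E^{\ge n}$ is open with $\sigma_E^n|_V$ injective, and $\sigma_E^m(U)=\sigma_E^n(V)$. The map $x\mapsto(x,0,x)$ is a homeomorphism of $\partial E$ onto the unit space $\mathcal{G}_E^0$. An isomorphism of groupoids is a groupoid isomorphism that is also a homeomorphism. An isomorphism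 $\phi:\mathcal{G}_E\to\mathcal{G}_F$ maps $\mathcal{G}_E^0$ onto $\mathcal{G}_F^0$, so there is a unique homeomorphism $h:\partial E\to\partial F$ with $\phi((x,0,x))=(h(x),0,h(x))$ for all $x\in\partial E$; this $h$ is called the homeomorphism induced by $\phi$, and one says $\phi$ induces $h$. *)

(* Defs.v *)
From HB Require Import structures.
From mathcomp Require Import all_boot all_order all_algebra.
From mathcomp Require Import zify.
From mathcomp Require Import all_classical topology.

Set Implicit Arguments.
Unset Strict Implicit.
Unset Printing Implicit Defensive.

Import GRing.Theory.

Local Open Scope classical_set_scope.

Record digraph := Digraph {
  vertex : countType;
  edge : countType;
  rng : edge -> vertex;
  src : edge -> vertex }.

Section Graph.
Variable E : digraph.

Definition outedges (v : vertex E) : set (edge E) := [set e | src e = v].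

Definition singular (v : vertex E) : Prop :=
  outedges v = set0 \/ infinite_set (outedges v).

(** A finite path is a pair [(v, s)] of its source [v] and its edge list [s]
    that satisfies [walk v s]; a vertex [v] is the path [(v, [::])]. *)
Definition prepath : Type := (vertex E * seq (edge E))%type.

Fixpoint walk (v : vertex E) (s : seq (edge E)) : bool :=
  if s is e :: s' then (src e == v) && walk (rng e) s' else true.

Definition is_path (mu : prepath) : bool := walk mu.1 mu.2.

Definition path_rng (mu : prepath) : vertex E :=
  last mu.1 [seq rng e | e <- mu.2].

Definition path_rcons (mu : prepath) (e : edge E) : prepath :=
  (mu.1, rcons mu.2 e).

Definition is_ipath (u : nat -> edge E) : Prop :=
  forall i, rng (u i) = src (u i.+1).

Definition rawpath : Type := (prepath + (nat -> edge E))%type.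

Definition is_bpath (x : rawpath) : bool :=
  match x with
  | inl mu => is_path mu && `[< singular (path_rng mu) >]
  | inr u => `[< is_ipath u >]
  end.

Record bpath := BPath { bval : rawpath; bvalP : is_bpath bval }.

HB.instance Definition _ := [isSub for bval].
HB.instance Definition _ := [Choice of bpath by <:].

Definition infinite_path (x : bpath) : Prop := exists u, bval x = inr u.

Definition bsrc (x : bpath) : vertex E :=
  match bval x with inl mu => mu.1 | inr u => src (u 0) end.

(** [blen_ge n] is the set of boundary paths of length at least [n]. *)
Definition blen_ge (n : nat) : set bpath :=
  [set x | match bval x with inl mu => n <= size mu.2 | inr _ => true end].

(** The concatenation [mu x], meaningful when the range of [mu] is the source
    of [x]. *)
Definition path_cat (mu : prepath) (x : rawpath) : rawpath :=
  match x with
  | inl nu => inl (mu.1, mu.2 ++ nu.2)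
  | inr u => inr (fun i => if i < size mu.2 then nth (u 0) mu.2 i
                           else u (i - size mu.2))
  end.

Definition cylinder (mu : prepath) : set bpath :=
  [set y | exists2 x : bpath,
     bsrc x = path_rng mu & bval y = path_cat mu (bval x)].

Definition cylinderD (mu : prepath) (A : set (edge E)) : set bpath :=
  cylinder mu `\` \bigcup_(e in A) cylinder (path_rcons mu e).

Definition bpath_basis : set (set bpath) :=
  [set B | exists mu A,
     [/\ is_path mu, finite_set A, A `<=` outedges (path_rng mu) &
         B = cylinderD mu A]].

(** The sets of [bpath_basis] are a basis of the topology that they generate,
    so declaring them as a subbase gives the intended topology. *)
HB.instance Definition _ := isSubBaseTopological.Build bpath bpath_basis id.

(** The shift is made total by fixing the paths of length [0], which are
    outside its domain [blen_ge 1]. *)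
Definition raw_shift (x : rawpath) : rawpath :=
  match x with
  | inl (_, e :: s) => inl (rng e, s)
  | inl (v, [::]) => inl (v, [::])
  | inr u => inr (fun i => u i.+1)
  end.

Lemma raw_shiftP (x : rawpath) : is_bpath x -> is_bpath (raw_shift x).
Proof.
case: x => [[v [|e s]]|u] //=; rewrite /is_path /path_rng /=.
- by rewrite -andbA => /and3P[_ -> ->].
- by move=> /asboolP h; apply/asboolP => i; exact: h.
Qed.

Definition shift (x : bpath) : bpath := BPath (raw_shiftP (bvalP x)).

(** The assertion that the [m]-fold shift of [x] and the [n]-fold shift of [y] are
    both defined and are equal. *)
Definition shift_eq (m : nat) (x : bpath) (n : nat) (y : bpath) : Prop :=
  [/\ blen_ge m x, blen_ge n y & iter m shift x = iter n shift y].

Definition eventually_periodic (x : bpath) : Prop :=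
  infinite_path x /\ exists n p, 0 < p /\ shift_eq (n + p) x n x.

Definition isolated_eventually_periodic : set bpath :=
  [set x | eventually_periodic x /\ open [set x]].

Definition raw_arrow : Type := (bpath * int * bpath)%type.

Definition is_arrow (g : raw_arrow) : Prop :=
  exists m n : nat,
    g.1.2 = (m%:Z - n%:Z)%R /\ shift_eq m g.1.1 n g.2.

Record groupoid := Arrow { aval : raw_arrow; avalP : `[< is_arrow aval >] }.

HB.instance Definition _ := [isSub for aval].
HB.instance Definition _ := [Choice of groupoid by <:].

Definition arng (g : groupoid) : bpath := (aval g).1.1.
Definition adeg (g : groupoid) : int := (aval g).1.2.
Definition asrc (g : groupoid) : bpath := (aval g).2.

Lemma blen_geS n x : blen_ge n.+1 x <-> blen_ge 1 x /\ blen_ge n (shift x).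
Proof. by case: x => -[[v [|e s]]|u] h; split=> // -[]. Qed.

Lemma blen_geD m n x :
  blen_ge (m + n) x <-> blen_ge m x /\ blen_ge n (iter m shift x).
Proof.
elim: m x => [|m IH] x.
  by split=> [h|[]//]; split=> //; case: x h => -[].
rewrite addSn iterSr; split.
  by move=> /blen_geS[h1 /IH[h2 h3]]; split=> //; apply/blen_geS.
by move=> [/blen_geS[h1 h2] h3]; apply/blen_geS; split=> //; apply/IH.
Qed.

Lemma shift_eqD m x n y p :
  shift_eq m x n y -> blen_ge (n + p) y -> shift_eq (p + m) x (p + n) y.
Proof.
move=> [hx hy e] /blen_geD[_ hp]; split; rewrite ?iterD ?e //.
- by rewrite addnC; apply/blen_geD; rewrite e.
- by rewrite addnC; apply/blen_geD.
Qed.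

Lemma shift_eqC m x n y : shift_eq m x n y -> shift_eq n y m x.
Proof. by case. Qed.

Lemma unitP (x : bpath) : `[< is_arrow (x, 0%R, x) >].
Proof.
apply/asboolP; exists 0, 0; split; first by rewrite subrr.
by case: x => -[].
Qed.

Definition aunit (x : bpath) : groupoid := Arrow (unitP x).

Lemma invP (g : groupoid) : `[< is_arrow (asrc g, - adeg g, arng g)%R >].
Proof.
case: g => -[[x k] y] /= /[dup] /asboolP[m [n [/= -> h]]] ?.
by apply/asboolP; exists n, m; rewrite /adeg /= opprB; split=> //; apply: shift_eqC.
Qed.

Definition ainv (g : groupoid) : groupoid := Arrow (invP g).

Definition composable (g h : groupoid) : Prop := asrc g = arng h.

Lemma mulP (g h : groupoid) : composable g h ->
  `[< is_arrow (arng g, adeg g + adeg h, asrc h)%R >].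
Proof.
case: g h => -[[x k] y] gP [[[w l] z] hP]; rewrite /composable /arng /adeg /asrc /=.
move: gP hP => /asboolP[m [n [/= -> gP]]] /asboolP[p [q [/= -> hP]]] yw.
subst w; apply/asboolP.
have [np|/ltnW pn] := leqP n p.
- exists (p - n + m), q; split=> /=.
    by rewrite PoszD -subzn //; lia.
  have [|a b c] := @shift_eqD m x n y (p - n) gP.
    by rewrite subnKC //; case: hP.
  by case: hP => d f e; split=> //; rewrite c subnK.
- exists m, (n - p + q); split=> /=.
    by rewrite PoszD -subzn //; lia.
  have [|a b c] := @shift_eqD q z p y (n - p) (shift_eqC hP).
    by rewrite subnKC //; case: gP.
  by case: gP => d f e; split=> //; rewrite e c subnK.
Qed.

Definition amul (g h : groupoid) (gh : composable g h) : groupoid :=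
  Arrow (mulP gh).

Definition arrow_set (U : set bpath) (m n : nat) (V : set bpath) :
    set groupoid :=
  [set g | [/\ U (arng g), adeg g = (m%:Z - n%:Z)%R, V (asrc g) &
               shift_eq m (arng g) n (asrc g)]].

Definition groupoid_subbasis : set (set groupoid) :=
  [set W | exists U m n V,
     [/\ [/\ U `<=` blen_ge m, open U & set_inj U (iter m shift)],
         [/\ V `<=` blen_ge n, open V & set_inj V (iter n shift)],
         iter m shift @` U = iter n shift @` V &
         W = arrow_set U m n V]].

HB.instance Definition _ :=
  isSubBaseTopological.Build groupoid groupoid_subbasis id.

End Graph.

Arguments blen_ge {E} n.
Arguments isolated_eventually_periodic E : clear implicits.

Definition inverse_homeomorphisms (S T : topologicalType)
    (f : S -> T) (g : T -> S) : Prop :=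
  [/\ cancel f g, cancel g f, continuous f & continuous g].

Definition homeomorphism (S T : topologicalType) (f : S -> T) : Prop :=
  exists g, inverse_homeomorphisms f g.

(** The functions [k] and [l] live on [blen_ge 1]; their values elsewhere are
    irrelevant, and continuity is for the subspace topology on [blen_ge 1]. *)
Definition shift_cocycles (E F : digraph) (h : bpath E -> bpath F) : Prop :=
  exists k l : bpath E -> nat,
    [/\ {within blen_ge 1, continuous k}, {within blen_ge 1, continuous l} &
        forall x, blen_ge 1 x -> shift_eq (k x) (h (shift x)) (l x) (h x)].

Definition orbit_equivalence (E F : digraph) (h : bpath E -> bpath F) : Prop :=
  exists g, [/\ inverse_homeomorphisms h g, shift_cocycles h & shift_cocycles g].

Definition preserves_isolated_eventually_periodic (E F : digraph)
    (h : bpath E -> bpath F) : Prop :=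
  h @` isolated_eventually_periodic E = isolated_eventually_periodic F.

Definition groupoid_hom (E F : digraph) (phi : groupoid E -> groupoid F) :
    Prop :=
  (forall g h (gh : composable g h),
     exists gh' : composable (phi g) (phi h), phi (amul gh) = amul gh') /\
  (forall g, phi (ainv g) = ainv (phi g)).

Definition groupoid_iso (E F : digraph) (phi : groupoid E -> groupoid F) :
    Prop :=
  exists psi, [/\ inverse_homeomorphisms phi psi,
                  groupoid_hom phi & groupoid_hom psi].

Definition induces (E F : digraph) (phi : groupoid E -> groupoid F)
    (h : bpath E -> bpath F) : Prop :=
  homeomorphism h /\ forall x, phi (aunit x) = aunit (h x).

(* Main.v *)
Require Import Defs.
From mathcomp Require Import all_boot all_order all_algebra.
From mathcomp Require Import zify.
From mathcomp Require Import all_classical topology.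

(** An orbit equivalence [h] provides, for each path [x] of positive length, an
    arrow from [h (shift x)] to [h x], of degree [c x = l x - k x], which depends
    continuously on [x]. Since every arrow [(x, m - n, y)] goes [m] steps forward
    from [x] and [n] steps back to [y], these arrows multiply up to a continuous
    morphism over [h], which sends it to an arrow of degree
    [c x + ... + c (shift^(m-1) x) - c y - ... - c (shift^(n-1) y)]
    ([cocycle_morphism]). Doing the same with the inverse of [h] gives a morphism
    in the other direction, and the composites are continuous endomorphisms over
    the identity.

    Such an endomorphism fixes every arrow whose range is not an isolated
    eventually periodic point ([continuous_over_id]). Indeed, if it changed the
    degree of an arrow with range [x], all paths [z] near [x] would satisfy
    [shift^m z = shift^n z] with fixed [m <> n], and such paths are determined by
    a prefix, so that [x] would be isolated ([near_shift_eq_isolated]).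

    At an isolated eventually periodic point the isotropy group is infinite cyclic,
    and so is the isotropy group of its image, because [h] preserves such points;
    but the morphism may multiply the generator by any integer. This is repaired
    by changing [c] at one path on each cycle that carries an isolated
    path, so that one turn around the cycle is sent to a generator
    ([corrected_cocycle]). Such a cycle has no exit, hence the chosen path is the
    only one with its first edge; the chosen paths therefore do not accumulate at
    any path of positive length, and the corrected cocycle is still continuous
    ([near_not_cycle_base]). The resulting morphism is bijective, and its inverse
    is continuous because the range maps of both groupoids are local
    homeomorphisms.

    Conversely, an isomorphism sends the arrow from [shift x] to [x] to an arrow
    from [h (shift x)] to [h x], whose exponents may be used for all paths near
    [x]. Continuous [k] and [l] arise from a locally constant choice among these
    exponents, which exists because the boundary path space has a countable basis of
    clopen sets ([locally_constant_selection]). Isolated eventually periodic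
    points are preserved because they are the isolated points with nontrivial
    isotropy. *)

Set Implicit Arguments.
Unset Strict Implicit.
Unset Printing Implicit Defensive.

Import GRing.Theory.
Local Open Scope classical_set_scope.

(* With the graph left implicit, [shift] can be iterated. *)
Local Notation shift := (@shift _).

(** * Boundary paths by head edge and shift *)

Section BoundaryPaths.
Variable E : digraph.
Implicit Types (x y z w : bpath E) (e : edge E) (v : vertex E).

Definition bhead x : option (edge E) :=
  match bval x with
  | inl (_, e :: _) => Some e
  | inl (_, [::]) => None
  | inr u => Some (u 0)
  end.

Lemma bval_inj : injective (@bval E).
Proof. exact: val_inj. Qed.

Lemma blen_ge0 x : blen_ge 0 x.
Proof. by case: x => -[]. Qed.

Lemma blen_ge1P x : blen_ge 1 x <-> exists e, bhead x = Some e.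
Proof.
rewrite /blen_ge /bhead /=; case: (bval x) => [[v [|e s]]|u] /=.
- by split=> // -[].
- by split=> // _; exists e.
- by split=> // _; exists (u 0).
Qed.

Lemma bhead_src x e : bhead x = Some e -> bsrc x = src e.
Proof.
case: x => -[[v [|f s]]|u] //= h; rewrite /bhead /bsrc /= => -[<-] //.
by move: h; rewrite /is_path /= => /andP[/andP[/eqP]].
Qed.

Lemma bsrc_shift x e : bhead x = Some e -> bsrc (shift x) = rng e.
Proof.
case: x => -[[v [|f s]]|u] //= h; rewrite /bhead /bsrc /= => -[<-] //.
by move: h => /asboolP ->.
Qed.

Lemma bcons e y : bsrc y = rng e -> exists2 x, bhead x = Some e & shift x = y.
Proof.
case: y => -[[v s]|u] h /=; rewrite /bsrc /= => hv.
- subst v; have h' : @is_bpath E (inl (src e, e :: s)).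
    by move: h; rewrite /= /is_path /path_rng /= eqxx.
  by exists (BPath h') => //; apply: bval_inj.
- have h' : @is_bpath E (inr (fun i => if i is j.+1 then u j else e)).
    by move/asboolP: h => h; apply/asboolP => -[|i].
  by exists (BPath h') => //; apply: bval_inj.
Qed.

Lemma shift_inj_bhead x z e :
  bhead x = Some e -> bhead z = Some e -> shift x = shift z -> x = z.
Proof.
move=> hx hz hs; apply: bval_inj; have [sx sz] := (bhead_src hx, bhead_src hz).
have := congr1 (@bval E) hs; move: hx hz sx sz; rewrite /shift /bhead /bsrc /=.
case: (bval x) (bval z) => [[v [|f s]]|u] [[v' [|f' s']]|u'] //=.
- by move=> [->] [->] -> -> [->].
- move=> [h0] [h0'] _ _ [h]; congr inr.
  apply/funext => -[|i]; first by rewrite h0.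
  by move/(congr1 (fun f => f i)): h.
Qed.

Lemma cylinder_nil v x : cylinder (v, [::]) x <-> bsrc x = v.
Proof.
split=> [[y sy hx]|hx].
- rewrite -[RHS]sy; move: sy hx; rewrite /bsrc; case: (bval y) => [[w s]|u] /=.
    by move=> ? ->.
  by move=> ? ->.
- exists x => //; rewrite -hx /bsrc; case: (bval x) => [[w s]|u] //=.
  by congr inr; apply/funext => i; rewrite subn0.
Qed.

Lemma cylinder_cons e s x :
  cylinder (src e, e :: s) x <->
  bhead x = Some e /\ cylinder (rng e, s) (shift x).
Proof.
split=> [[y sy hx]|[hx [y sy hy]]].
- split.
    by move: hx; rewrite /bhead; case: (bval y) => [[w t]|u] /= ->.
  exists y; first exact: sy.
  by move: hx; rewrite /shift /=; case: (bval y) => [[w t]|u] /= ->.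
- exists y; first exact: sy.
  have := bhead_src hx; move: hx hy; rewrite /shift /bhead /bsrc /=.
  case: (bval x) => [[v [|f t]]|u] //=; case: (bval y) => [[w t']|u'] //=.
  + by move=> [->] [->] ->.
  + move=> [h] [h'] _; congr inr; apply/funext => -[|i] //=.
    by move/(congr1 (fun f => f i)): h' => /=.
Qed.

Lemma cylinder_bsrc mu x : is_path mu -> cylinder mu x -> bsrc x = mu.1.
Proof.
case: mu => v [|e s]; first by move=> _ /cylinder_nil.
by rewrite /is_path /= => /andP[/eqP <- _] /cylinder_cons[/bhead_src].
Qed.

Lemma cylinderD_cons e s A x :
  cylinderD (src e, e :: s) A x <->
  bhead x = Some e /\ cylinderD (rng e, s) A (shift x).
Proof.
split=> [[/cylinder_cons[hx hs] hn]|[hx [hs hn]]]; split=> //.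
- split=> // -[f Af hf]; apply: hn; exists f => //.
  by rewrite /path_rcons /=; apply/cylinder_cons.
- by apply/cylinder_cons.
- by move=> [f Af /cylinder_cons[_ hf]]; apply: hn; exists f.
Qed.

End BoundaryPaths.

(** * Neighborhoods from a subbase *)

Section Subbase.

(** A basic open set is a finite intersection of subbasic ones, and a filter is
    closed under finite intersections. *)
Lemma finI_from_filter (T : choiceType) (P : set (set T)) (F : set_system T)
    (t : T) (U : set T) :
  Filter F -> (forall B, P B -> B t -> F B) ->
  [set \bigcup_(B in D) B | D in subset^~ (finI_from P id)] U -> U t -> F U.
Proof.
move=> FF hP [D hD <-] [B DB Bt].
have [Q hQ hB] := hD _ DB.
apply: (@filterS _ F _ B); first by move=> z Bz; exists B.
rewrite -hB; apply: filter_bigI => C CQ.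
apply: hP; first by have := hQ _ CQ; rewrite inE.
by move: Bt; rewrite -hB; apply.
Qed.

Lemma finI_from_open (T : choiceType) (P : set (set T)) (B : set T) :
  P B -> [set \bigcup_(B in D) B | D in subset^~ (finI_from P id)] B.
Proof.
move=> PB; exists [set B]; last by rewrite bigcup_set1.
by move=> _ ->; apply: (@finI_from1 _ _ P id).
Qed.

Variable E : digraph.

Lemma nbhs_bpath_filter (F : set_system (bpath E)) (x : bpath E) :
  Filter F -> (forall B, bpath_basis B -> B x -> F B) -> F --> x.
Proof.
move=> FF hP A; rewrite /= nbhsE => -[B [Bop Bx] sBA].
apply: filterS sBA _.
exact: (finI_from_filter FF hP Bop).
Qed.

Lemma open_bpath_basis (B : set (bpath E)) : bpath_basis B -> open B.
Proof. exact: finI_from_open. Qed.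

Lemma nbhs_groupoid_filter (F : set_system (groupoid E)) (g : groupoid E) :
  Filter F -> (forall B, groupoid_subbasis B -> B g -> F B) -> F --> g.
Proof.
move=> FF hP A; rewrite /= nbhsE => -[B [Bop Bx] sBA].
apply: filterS sBA _.
exact: (finI_from_filter FF hP Bop).
Qed.

Lemma open_groupoid_subbasis (B : set (groupoid E)) :
  groupoid_subbasis B -> open B.
Proof. exact: finI_from_open. Qed.
End Subbase.

(** * The shift is a local homeomorphism *)

Section LocalHomeo.
Variable E : digraph.
Implicit Types (x y z w : bpath E) (e : edge E) (v : vertex E).

Lemma cylinder_open mu : is_path mu -> open (@cylinder E mu).
Proof.
move=> hmu; apply: open_bpath_basis; exists mu, set0; split=> //.
by rewrite /cylinderD bigcup_set0 setD0.
Qed.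

Lemma near_bsrc x : \forall z \near x, bsrc z = bsrc x.
Proof.
have : nbhs x (cylinder (bsrc x, [::])).
  by apply: open_nbhs_nbhs; split; [exact: cylinder_open|exact/cylinder_nil].
by apply: filterS => z /cylinder_nil.
Qed.

Lemma near_bhead x e : bhead x = Some e -> \forall z \near x, bhead z = Some e.
Proof.
move=> hx; have : nbhs x (cylinder (src e, [:: e])).
  apply: open_nbhs_nbhs; split.
    by apply: cylinder_open; rewrite /is_path /= eqxx.
  by apply/cylinder_cons; split=> //; apply/cylinder_nil/bsrc_shift.
by apply: filterS => z /cylinder_cons[].
Qed.

Lemma shift_continuous x : blen_ge 1 x -> {for x, continuous shift}.
Proof.
move=> /blen_ge1P[e hx].
apply: (nbhs_bpath_filter (fmap_filter _ (nbhs_filter x))).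
move=> B [mu [A [hmu fA sA ->]]] hs.
have hmu1 : mu.1 = rng e.
  by rewrite -(bsrc_shift hx); case: hs => /(cylinder_bsrc hmu).
have hB : bpath_basis (cylinderD (src e, e :: mu.2) A).
  exists (src e, e :: mu.2), A; split=> //.
    by rewrite /is_path /= eqxx /= -hmu1.
  by move=> f /sA; rewrite /path_rng /= hmu1.
have : nbhs x (cylinderD (src e, e :: mu.2) A).
  apply: open_nbhs_nbhs; split; first exact: open_bpath_basis.
  by apply/cylinderD_cons; rewrite -hmu1 -surjective_pairing.
by apply: filterS => z /cylinderD_cons[_]; rewrite -hmu1 -surjective_pairing.
Qed.

(** Prepending a fixed edge, which inverts the shift on a cylinder, is
    continuous: under it, membership in a subbasic set around [x] turns into
    membership in another subbasic set, or holds throughout. *)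
Lemma nbhs_unshift x e (S : set (bpath E)) : bhead x = Some e -> nbhs x S ->
  \forall w \near shift x, forall z, bhead z = Some e -> shift z = w -> S z.
Proof.
move=> hx.
pose F : set_system (bpath E) := [set S |
  \forall w \near shift x, forall z, bhead z = Some e -> shift z = w -> S z].
have FF : Filter F.
  split; rewrite /F.
  - by apply: (@filterE _ (nbhs (shift x))) => w z _ _.
  - move=> P Q; apply: (@filterS2 _ (nbhs (shift x))) => w hPw hQw z hz hw.
    by split; [exact: hPw|exact: hQw].
  - move=> P Q PQ; apply: (@filterS _ (nbhs (shift x))) => w hw z hz zw.
    exact/PQ/hw.
have FF_cvg : F --> x; last exact: FF_cvg.
apply: (nbhs_bpath_filter FF) => B [[v s] [A [hmu fA sA ->]]] hB; rewrite /F /=.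
have hv : v = src e.
  by rewrite -(bhead_src hx); case: hB => /(cylinder_bsrc hmu).
subst v; case: s hmu sA hB => [|f s] hmu sA hB.
- apply: (@filterE _ (nbhs (shift x))) => w z hz _; split.
    by apply/cylinder_nil; exact: bhead_src.
  move=> [f Af]; have hf : src f = src e := sA f Af.
  rewrite /path_rcons /= -hf => /cylinder_cons[].
  rewrite hz => -[ef] _; case: hB => _; apply; exists f => //.
  rewrite /path_rcons /= -hf; apply/cylinder_cons; rewrite -ef; split=> //.
  exact/cylinder_nil/bsrc_shift.
- have /andP[/eqP /= sf hs] := hmu.
  move: hB; rewrite -sf => /cylinderD_cons[]; rewrite hx => -[ef] hB; subst f.
  have : nbhs (shift x) (cylinderD (rng e, s) A).
    apply: open_nbhs_nbhs; split=> //; apply: open_bpath_basis.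
    by exists (rng e, s), A; split.
  by apply: filterS => w hw z hz hzw; apply/cylinderD_cons; rewrite hzw.
Unshelve. all: by end_near. Qed.

Lemma shift_open x (S : set (bpath E)) : blen_ge 1 x -> nbhs x S ->
  nbhs (shift x) (shift @` S).
Proof.
move=> /blen_ge1P[e hx] hS.
have h1 := nbhs_unshift hx hS; have h2 := near_bsrc (shift x).
near=> w; have [|z hz zw] := @bcons _ e w.
  by rewrite -(bsrc_shift hx); near: w.
by exists z => //; move: z hz zw; near: w.
Unshelve. all: by end_near. Qed.

Lemma blen_geS_iter m x :
  blen_ge m.+1 x <-> blen_ge m x /\ blen_ge 1 (iter m shift x).
Proof. by rewrite -addn1; exact: blen_geD. Qed.

Lemma iter_shift_continuous m x :
  blen_ge m x -> {for x, continuous (iter m shift)}.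
Proof.
elim: m x => [|m IH] x; first by move=> _; exact: cvg_id.
move=> /blen_geS_iter[h1 h2].
apply: (@continuous_comp _ _ _ (iter m shift) shift); first exact: IH.
exact: shift_continuous.
Qed.

Lemma iter_shift_open m x (S : set (bpath E)) : blen_ge m x -> nbhs x S ->
  nbhs (iter m shift x) (iter m shift @` S).
Proof.
elim: m x S => [|m IH] x S; first by rewrite image_id.
move=> /blen_geS_iter[h1 h2] /(IH _ _ h1)/(shift_open h2).
by rewrite image_comp.
Qed.

Lemma near_blen m x : blen_ge m x -> \forall z \near x, blen_ge m z.
Proof.
elim: m x => [|m IH] x; first by move=> _; apply: filterE => z; exact: blen_ge0.
move=> /blen_geS_iter[h1 h2]; have [e he] := (blen_ge1P _).1 h2.
have h3 := IH _ h1; have h4 := iter_shift_continuous h1 (near_bhead he).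
near=> z; apply/blen_geS_iter; split; first by near: z.
by apply/blen_ge1P; exists e; near: z.
Unshelve. all: by end_near. Qed.

(** The neighborhood consists of the paths that share their first [m] edges with
    [x]. *)
Lemma iter_shift_locally_inj m x : blen_ge m x ->
  exists2 U, nbhs x U & set_inj U (iter m shift).
Proof.
elim: m x => [|m IH] x; first by move=> _; exists setT => //; exact: filterT.
move=> /blen_geS_iter[h1 h2]; have [e he] := (blen_ge1P _).1 h2.
have [U hU iU] := IH _ h1; have h4 := iter_shift_continuous h1 (near_bhead he).
exists (U `&` [set z | bhead (iter m shift z) = Some e]); first exact: filterI.
move=> z w /set_mem[Uz ez] /set_mem[Uw ew] /= hzw.
apply: iU; rewrite ?inE //; exact: (shift_inj_bhead ez ew hzw).
Qed.

End LocalHomeo.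

(** * Shift equations and periodic paths *)

Section ShiftEquations.
Variable E : digraph.
Implicit Types (x y z w : bpath E) (e : edge E) (v : vertex E).

Lemma blen_ge_le m n x : m <= n -> blen_ge n x -> blen_ge m x.
Proof. by move=> /subnKC <- /blen_geD[]. Qed.

Lemma infinite_pathP x : infinite_path x <-> forall m, blen_ge m x.
Proof.
rewrite /infinite_path /blen_ge /=; split=> [[u ->] //|].
case: (bval x) => [[v s] /(_ (size s).+1) /=|u _]; first by rewrite ltnn.
by exists u.
Qed.

Lemma shift_eq_trans m x n y p q z :
  shift_eq m x n y -> shift_eq p y q z ->
  shift_eq (m + (p - n)) x (q + (n - p)) z.
Proof.
move=> h1 h2; have [a1 b1 e1] := h1; have [a2 b2 e2] := h2.
have [np|/ltnW pn] := leqP n p.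
- have -> : n - p = 0 by apply/eqP; rewrite subn_eq0.
  have [|a b c] := shift_eqD (p := p - n) h1; first by rewrite subnKC.
  by split; rewrite ?addn0 1?addnC // c subnK.
- have -> : p - n = 0 by apply/eqP; rewrite subn_eq0.
  have [|a b c] := shift_eqD (p := n - p) (shift_eqC h2).
    by rewrite subnKC.
  by split; rewrite ?addn0 1?addnC // c subnK.
Qed.

Lemma arrow_shift_eq m x n y :
  shift_eq m x n y -> is_arrow (x, m%:Z - n%:Z, y)%R.
Proof. by move=> h; exists m, n. Qed.

Lemma is_arrow_refl x : is_arrow (x, 0%R, x).
Proof. exact: (asboolP _ (unitP x)). Qed.

Lemma is_arrow_sym x c y : is_arrow (x, c, y) -> is_arrow (y, - c, x)%R.
Proof.
by move=> [m [n [/= -> h]]]; rewrite opprB; exact/arrow_shift_eq/shift_eqC.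
Qed.

Lemma is_arrow_trans x c y d z :
  is_arrow (x, c, y) -> is_arrow (y, d, z) -> is_arrow (x, c + d, z)%R.
Proof.
move=> [m [n [/= -> h]]] [p [q [/= -> h']]].
have -> : (m%:Z - n%:Z + (p%:Z - q%:Z) =
          (m + (p - n))%N%:Z - (q + (n - p))%N%:Z)%R by lia.
by apply: arrow_shift_eq; exact: shift_eq_trans h h'.
Qed.

(** Through the equation, a prefix of length [m + k] of [x] yields one of length
    [n + k]. *)
Lemma shift_eq_infinite m n x : m < n -> shift_eq m x n x -> infinite_path x.
Proof.
move=> mn [h1 h2 e]; apply/infinite_pathP => k.
suff h : blen_ge (m + k) x by apply: blen_ge_le h; exact: leq_addl.
elim: k => [|k /blen_geD[_]]; first by rewrite addn0.
rewrite e => h; apply: (@blen_ge_le _ (n + k)); last exact/blen_geD.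
by rewrite addnS ltn_add2r.
Qed.

Lemma eventually_periodicP x :
  eventually_periodic x <-> exists2 c, c != 0%R & is_arrow (x, c, x).
Proof.
split=> [[_ [n [p [p0 h]]]]|[c c0 [m [n [/= ec h]]]]].
  by exists ((n + p)%N%:Z - n%:Z)%R; [lia|exact: arrow_shift_eq].
have [mn|nm|mn] := ltngtP m n; last by lia.
- split; first exact: shift_eq_infinite h.
  exists m, (n - m); split; first by lia.
  by rewrite subnKC; [exact: shift_eqC|exact: ltnW].
- split; first exact: shift_eq_infinite (shift_eqC h).
  exists n, (m - n); split; first by lia.
  by rewrite subnKC //; exact: ltnW.
Qed.

Lemma bhead_iter x u i : bval x = inr u -> bhead (iter i shift x) = Some (u i).
Proof.
move=> hx; suff : bval (iter i shift x) = inr (fun j => u (j + i)).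
  by rewrite /bhead => ->.
elim: i => [|i IH] /=.
  by rewrite hx; congr inr; apply/funext => j; rewrite addn0.
by rewrite IH /=; congr inr; apply/funext => j; rewrite addSnnS.
Qed.

Lemma ipath_ext x z : infinite_path x ->
  (forall i, bhead (iter i shift z) = bhead (iter i shift x)) -> z = x.
Proof.
move=> [u hx] h; have [u' hz] : infinite_path z.
  apply/infinite_pathP; elim=> [|m IH]; first exact: blen_ge0.
  apply/blen_geS_iter; split=> //; apply/blen_ge1P; exists (u m).
  by rewrite h; exact: bhead_iter.
apply: bval_inj; rewrite hx hz; congr inr; apply/funext => i.
by have := h i; rewrite (bhead_iter _ hx) (bhead_iter _ hz) => -[].
Qed.

Lemma near_prefix n x : blen_ge n x ->
  \forall z \near x, forall i, i < n ->
    bhead (iter i shift z) = bhead (iter i shift x).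
Proof.
elim: n => [|n IH]; first by move=> _; apply: filterE.
move=> /blen_geS_iter[h1 /blen_ge1P[e he]].
have h3 := IH h1; have h4 := iter_shift_continuous h1 (near_bhead he).
near=> z => i; rewrite ltnS leq_eqVlt => /orP[/eqP -> {i}|].
  by rewrite he; near: z.
by move: i; near: z.
Unshelve. all: by end_near. Qed.

Lemma open_set1 x : open [set x] <-> nbhs x [set x].
Proof.
split=> [ox|nx]; first exact: open_nbhs_nbhs.
by rewrite openE => _ ->.
Qed.

(** A path [z] with this property is determined by its first [max m n] edges: from
    then on, each edge repeats the one [|m - n|] places earlier. Near [x] the
    first edges of [z] are those of [x]. *)
Lemma near_shift_eq_isolated x m n : m != n ->
  (\forall z \near x, shift_eq m z n z) -> isolated_eventually_periodic E x.
Proof.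
wlog mn : m n / m < n => [hw mn h|_ h].
  have [lt|gt] := ltnP m n; first exact: (hw m n).
  apply: (hw n m); [lia|by rewrite eq_sym|].
  by apply: filterS h => z; exact: shift_eqC.
have hx := nbhs_singleton h; have ix := shift_eq_infinite mn hx.
split.
  apply/eventually_periodicP; exists (m%:Z - n%:Z)%R; first lia.
  exact: arrow_shift_eq.
apply/open_set1; have hp := near_prefix ((infinite_pathP x).1 ix n).
near=> z; apply: ipath_ext => // i.
have [_ _ ez] : shift_eq m z n z by near: z.
have [_ _ ex] := hx.
have hz : forall i, i < n -> bhead (iter i shift z) = bhead (iter i shift x).
  by near: z.
elim/ltn_ind: i => i IH; have [/hz //|ni] := ltnP i n.
rewrite -(subnK ni) !iterD -ez -ex -!iterD; apply: IH; lia.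
Unshelve. all: by end_near. Qed.

(** One edge beyond [mu] has to be compared, because it decides whether an edge of
    [A] follows [mu]. *)
Lemma cylinderD_prefix mu A x z :
  is_path mu -> A `<=` outedges (path_rng mu) ->
  blen_ge (size mu.2).+1 x ->
  (forall i, i <= size mu.2 ->
    bhead (iter i shift z) = bhead (iter i shift x)) ->
  cylinderD mu A x -> cylinderD mu A z.
Proof.
case: mu => v s /=; elim: s v x z => [|f s IH] v x z hmu sA hx hz.
- have [e he] := (blen_ge1P _).1 hx; have := hz 0 isT; rewrite /= he => hze.
  move=> [/cylinder_nil hv hn]; split.
    by apply/cylinder_nil; rewrite (bhead_src hze) -(bhead_src he).
  move=> [f Af hf]; apply: hn; exists f => //; move: hf.
  have <- : src f = v := sA f Af.
  move=> /cylinder_cons[]; rewrite hze -he => hxf _.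
  by apply/cylinder_cons; split=> //; exact/cylinder_nil/bsrc_shift.
- have /andP[/= /eqP sf hs] := hmu; rewrite -sf.
  move=> /cylinderD_cons[hf hc]; apply/cylinderD_cons; split.
    by rewrite -hf; exact: (hz 0 isT).
  apply: (IH _ (shift x)) => //; first by case/blen_geS: hx.
  by move=> i hi; rewrite -!iterSr; exact: hz.
Qed.

Lemma nbhs_infinite x S : infinite_path x -> nbhs x S ->
  exists n, forall z,
    (forall i, i <= n -> bhead (iter i shift z) = bhead (iter i shift x)) ->
    S z.
Proof.
move=> ix.
pose agree n : set (bpath E) := [set z |
  forall i, i <= n -> bhead (iter i shift z) = bhead (iter i shift x)].
pose F : set_system (bpath E) := filter_from setT agree.
have FF : Filter F.
  apply: filter_from_filter; first by exists 0.
  move=> i j _ _; exists (maxn i j) => // z hz; split=> k hk; apply: hz.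
    by rewrite leq_max hk.
  by rewrite leq_max hk orbT.
have Fx : F --> x.
  apply: (nbhs_bpath_filter FF) => B [mu [A [hmu fA sA ->]]] hB.
  exists (size mu.2) => // z hz; apply: cylinderD_prefix hB => //.
  exact: (infinite_pathP x).1.
by move=> /Fx [n _ h]; exists n.
Qed.

Lemma prepend n x z : blen_ge n x -> bsrc z = bsrc (iter n shift x) ->
  exists2 w, iter n shift w = z &
    forall i, i < n -> bhead (iter i shift w) = bhead (iter i shift x).
Proof.
elim: n z => [|n IH] z; first by exists z.
move=> /blen_geS_iter[h1 /blen_ge1P[e he]].
rewrite iterS (bsrc_shift he) => /bcons[z1 hz1 hz].
have [|w hw hp] := IH z1 h1; first by rewrite (bhead_src hz1) (bhead_src he).
exists w; first by rewrite iterS hw.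
move=> i; rewrite ltnS leq_eqVlt => /orP[/eqP ->|]; last exact: hp.
by rewrite hw hz1 he.
Qed.

Lemma iter_period p x k : iter p shift x = x -> iter (k * p) shift x = x.
Proof. by move=> h; elim: k => [//|k IH]; rewrite mulSn iterD IH. Qed.

(** A cycle that carries an isolated periodic path has no exit: turning often
    enough around the cycle before following [z] produces a path that is too
    close to [x] to differ from it. *)
Lemma isolated_periodic_bhead p x z :
  infinite_path x -> nbhs x [set x] -> 0 < p -> iter p shift x = x ->
  bhead z = bhead x -> z = x.
Proof.
move=> ix nx p0 hp hzx; have [n hn] := nbhs_infinite ix nx.
have hnp : iter (n.+1 * p) shift x = x by exact: iter_period.
have [u hu] := ix; have hxu := bhead_iter 0 hu; rewrite /= in hxu.
have [||w hw hwx] := @prepend (n.+1 * p) x z.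
- exact: (infinite_pathP x).1.
- by rewrite hnp (bhead_src hxu) (@bhead_src _ z (u 0)) // hzx.
rewrite -hw (hn w) // => i hi; apply: hwx.
by apply: leq_ltn_trans hi _; exact: leq_pmulr.
Qed.

End ShiftEquations.

(** * The topology of the graph groupoid *)

Section GroupoidTopology.
Variable E : digraph.
Implicit Types (x y z w : bpath E) (g : groupoid E).

Lemma arrow_eq g g' :
  arng g = arng g' -> adeg g = adeg g' -> asrc g = asrc g' -> g = g'.
Proof.
rewrite /arng /adeg /asrc => h1 h2 h3; apply: val_inj => /=.
move: h1 h2 h3; case: (aval g) => -[a b] c; case: (aval g') => -[a' b'] c' /=.
by move=> -> -> ->.
Qed.

Lemma arrow_rep g :
  exists m n, adeg g = (m%:Z - n%:Z)%R /\ shift_eq m (arng g) n (asrc g).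
Proof.
by case: g => t ht; case: (asboolP _ ht) => m [n [h1 h2]]; exists m, n.
Qed.

Lemma arrow_of x c y : is_arrow (x, c, y) ->
  exists g, [/\ arng g = x, adeg g = c & asrc g = y].
Proof. by move=> /asboolT h; exists (Arrow h). Qed.

Lemma is_arrowP g : is_arrow (arng g, adeg g, asrc g).
Proof. by have [m [n [e h]]] := arrow_rep g; exists m, n. Qed.

Lemma set_injS (S T : Type) (A B : set S) (f : S -> T) :
  A `<=` B -> set_inj B f -> set_inj A f.
Proof.
move=> AB fB x y /set_mem/AB Bx /set_mem/AB By.
by apply: fB; exact: mem_set.
Qed.

(** Shrinking [U] and [V] makes the iterated shifts injective on them with equal
    images, as the definition of the topology requires. *)
Lemma nbhs_arrow_set g m n (U V : set (bpath E)) :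
  adeg g = (m%:Z - n%:Z)%R -> shift_eq m (arng g) n (asrc g) ->
  nbhs (arng g) U -> nbhs (asrc g) V -> nbhs g (arrow_set U m n V).
Proof.
move=> eg hg hU hV; have [bx hy exy] := hg.
have [U1 hU1 iU1] := iter_shift_locally_inj bx.
have [V1 hV1 iV1] := iter_shift_locally_inj hy.
pose A := (U `&` (U1 `&` blen_ge m))^°.
pose B := (V `&` (V1 `&` blen_ge n))^°.
have Ax : A (arng g).
  by do 2!apply: (@filterI _ (nbhs _)) => //; exact: near_blen.
have By : B (asrc g).
  by do 2!apply: (@filterI _ (nbhs _)) => //; exact: near_blen.
have sA : A `<=` U `&` (U1 `&` blen_ge m) by exact: interior_subset.
have sB : B `<=` V `&` (V1 `&` blen_ge n) by exact: interior_subset.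
pose U' := A `&` [set a | exists2 b, B b & iter m shift a = iter n shift b].
pose V' := B `&` [set b | exists2 a, A a & iter m shift a = iter n shift b].
have U'op : open U'.
  rewrite openE => a [Aa [b Bb hab]]; apply: (@filterI _ (nbhs a)).
    by apply: open_nbhs_nbhs; split=> //; exact: open_interior.
  have nb : nbhs b B by apply: open_nbhs_nbhs; split=> //; exact: open_interior.
  have := iter_shift_open (sB _ Bb).2.2 nb; rewrite -hab => hB.
  have := iter_shift_continuous (sA _ Aa).2.2 hB.
  by apply: (@filterS _ (nbhs a)) => z [c Bc hc]; exists c.
have V'op : open V'.
  rewrite openE => b [Bb [a Aa hab]]; apply: (@filterI _ (nbhs b)).
    by apply: open_nbhs_nbhs; split=> //; exact: open_interior.
  have na : nbhs a A by apply: open_nbhs_nbhs; split=> //; exact: open_interior.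
  have := iter_shift_open (sA _ Aa).2.2 na; rewrite hab => hA.
  have := iter_shift_continuous (sB _ Bb).2.2 hA.
  by apply: (@filterS _ (nbhs b)) => z [c Ac hc]; exists c.
have sub : arrow_set U' m n V' `<=` arrow_set U m n V.
  by move=> k [[/sA[Uk _] _] ek [/sB[Vk _] _] hk].
apply: filterS sub _; apply: open_nbhs_nbhs; split; last first.
  by split=> //; split=> //; [exists (asrc g)|exists (arng g)].
apply: open_groupoid_subbasis; exists U', m, n, V'; split=> //.
- split=> //; first by move=> z [/sA[_ []]].
  by apply: set_injS iU1 => z [/sA[_ []]].
- split=> //; first by move=> z [/sB[_ []]].
  by apply: set_injS iV1 => z [/sB[_ []]].
- apply/seteqP; split=> z /=.
    by move=> [a [Aa [b Bb hab]] <-]; exists b => //; split=> //; exists a.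
  by move=> [b [Bb [a Aa hab]] <-]; exists a => //; split=> //; exists b.
Qed.

(** A single pair of exponents gives a basis of neighborhoods of an arrow: a shift
    equation may be shifted further, and conversely local injectivity of the shift
    allows the same number of shifts to be cancelled on both sides. *)
Lemma arrow_set_nbhs g m n (W : set (groupoid E)) :
  adeg g = (m%:Z - n%:Z)%R -> shift_eq m (arng g) n (asrc g) -> nbhs g W ->
  exists U V, [/\ nbhs (arng g) U, nbhs (asrc g) V & arrow_set U m n V `<=` W].
Proof.
move=> eg hg.
pose F : set_system (groupoid E) := filter_from
  [set UV : set (bpath E) * set (bpath E) |
    nbhs (arng g) UV.1 /\ nbhs (asrc g) UV.2]
  (fun UV => arrow_set UV.1 m n UV.2).
have FF : Filter F.
  apply: filter_from_filter.
    by exists (setT, setT); split; exact: filterT.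
  move=> [U V] [U' V'] [/= hU hV] [/= hU' hV'].
  exists (U `&` U', V `&` V') => /=; first by split; exact: filterI.
  by move=> k [[? ?] ? [? ?] ?]; split; split.
suff Fg : F --> g by move=> /Fg[[U V] [hU hV] UV]; exists U, V.
apply: (nbhs_groupoid_filter FF) => B [U [m' [n' [V [hU hV _ ->]]]]].
have [sU oU _] := hU; have [sV oV _] := hV.
move=> [Ug eg' Vg hg'].
have nU : nbhs (arng g) U by apply: open_nbhs_nbhs; split.
have nV : nbhs (asrc g) V by apply: open_nbhs_nbhs; split.
have [mm|mm] := leqP m m'.
- have en : n' = n + (m' - m) by move: eg'; rewrite eg; lia.
  exists (U, V) => //= k [Uk ek Vk hk]; split=> //; first by rewrite -eg' eg.
  have := shift_eqD (p := m' - m) hk; rewrite -en => /(_ (sV _ Vk)).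
  by rewrite subnK // addnC -en.
- have en : n = n' + (m - m') by move: eg'; rewrite eg; lia.
  have em : m = m' + (m - m') by lia.
  set p := m - m' in en em; have [b' c' e'] := hg'; have [bg cg ee] := hg.
  have bp : blen_ge p (iter m' shift (arng g)).
    by move: bg; rewrite em => /blen_geD[].
  have [C hC iC] := iter_shift_locally_inj bp.
  exists (U `&` (iter m' shift @^-1` C), V `&` (iter n' shift @^-1` C)) => /=.
    split; apply: filterI => //; first exact: iter_shift_continuous.
    by apply: iter_shift_continuous => //; rewrite -e'.
  move=> k [[Uk Ck] ek [Vk Dk] [bk ck hk]]; split=> //.
    by rewrite -eg' eg.
  split; [exact: sU|exact: sV|].
  apply: iC; rewrite ?inE //.
  by move: hk; rewrite em en ![_ + p]addnC !iterD.
Qed.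

Lemma arng_continuous : continuous (@arng E).
Proof.
move=> g U hU; have [m [n [eg hg]]] := arrow_rep g.
apply: (@filterS _ (nbhs g) _ (arrow_set U m n setT)); first by move=> k [].
by apply: nbhs_arrow_set => //; exact: filterT.
Qed.

Lemma arng_open g (W : set (groupoid E)) :
  nbhs g W -> nbhs (arng g) (@arng E @` W).
Proof.
have [m [n [eg hg]]] := arrow_rep g; have [bg cg e] := hg.
move=> /(arrow_set_nbhs eg hg)[U [V [hU hV UV]]].
have hV' : nbhs (asrc g) (V `&` blen_ge n).
  by apply: filterI => //; exact: near_blen.
have := iter_shift_open cg hV'; rewrite -e => hw'.
have hw := iter_shift_continuous bg hw'; have bm := near_blen bg.
near=> z.
have [w [Vw bw] hzw] : (iter n shift @` (V `&` blen_ge n)) (iter m shift z).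
  by near: z.
have hz : shift_eq m z n w by split=> //; near: z.
have [k [k1 k2 k3]] := arrow_of (arrow_shift_eq hz).
exists k => //; apply: UV; split; rewrite ?k1 ?k2 ?k3 //.
by near: z.
Unshelve. all: by end_near. Qed.

Lemma arng_locally_inj g : exists2 W, nbhs g W & set_inj W (@arng E).
Proof.
have [m [n [eg hg]]] := arrow_rep g; have [bg cg e] := hg.
have [V hV iV] := iter_shift_locally_inj cg.
exists (arrow_set setT m n V).
  by apply: nbhs_arrow_set => //; exact: filterT.
move=> k k' /set_mem[_ ek Vk [_ _ hk]] /set_mem[_ ek' Vk' [_ _ hk']] kk'.
apply: arrow_eq => //; first by rewrite ek ek'.
by apply: iV; rewrite ?inE // -hk -hk' kk'.
Qed.

Lemma aunit_continuous : continuous (@aunit E).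
Proof.
move=> x W hW.
have [||U [V [hU hV UV]]] := @arrow_set_nbhs (aunit x) 0 0 W _ _ hW.
- by [].
- by split=> //; exact: blen_ge0.
suff : \forall z \near x, W (aunit z) by [].
near=> z; apply: UV; split; rewrite /arng /asrc /adeg //=.
- by near: z.
- by near: z.
- by split=> //; exact: blen_ge0.
Unshelve. all: by end_near. Qed.

(** This is continuity of the map that sends [z] to the arrow of degree [1] from
    [shift z] to [z], in a form that does not mention the map. *)
Lemma near_shift_arrow g (W : set (groupoid E)) : blen_ge 1 (arng g) ->
  adeg g = 1%R -> asrc g = shift (arng g) -> nbhs g W ->
  \forall z \near arng g, forall k,
    arng k = z -> adeg k = 1%R -> asrc k = shift z -> W k.
Proof.
move=> h1 hd hs hW; have sg : shift_eq 1 (arng g) 0 (asrc g).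
  by split=> //; exact: blen_ge0.
have [U [V [hU hV UV]]] := @arrow_set_nbhs g 1 0 W hd sg hW.
have hV' : \forall z \near arng g, V (shift z).
  by apply: shift_continuous => //; rewrite -hs.
have b1 := near_blen h1.
near=> z => k kz kd ks; apply: UV; split; rewrite ?kz ?ks //.
- by near: z.
- by near: z.
- by split; [near: z|exact: blen_ge0|].
Unshelve. all: by end_near. Qed.

(** If [theta g] and [g] had different degrees, then by continuity the arrows near
    [g] and their images would satisfy two shift equations of different degrees.
    Combined, these give [shift_eq] with distinct exponents for all paths near
    the range of [g], which happens only at isolated eventually periodic points. *)
Lemma continuous_over_id (theta : groupoid E -> groupoid E) g :
  {for g, continuous theta} -> (forall k, arng (theta k) = arng k) ->
  (forall k, asrc (theta k) = asrc k) ->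
  ~ isolated_eventually_periodic E (arng g) -> theta g = g.
Proof.
move=> ct hr hs nI; apply: contrapT => ng; apply: nI.
have [m [n [eg hg]]] := arrow_rep g.
have [m' [n' [et ht]]] := arrow_rep (theta g).
have n1 : nbhs g (theta @^-1` arrow_set setT m' n' setT).
  by apply: ct; apply: nbhs_arrow_set => //; exact: filterT.
have n2 : nbhs g (arrow_set setT m n setT).
  by apply: nbhs_arrow_set => //; exact: filterT.
have h := arng_open (@filterI _ _ (nbhs_filter g) _ _ n1 n2).
apply: (@near_shift_eq_isolated _ _ (m + (n' - n)) (m' + (n - n'))).
  apply/eqP => hmn; apply: ng; apply: arrow_eq => //.
  by rewrite et eg; lia.
apply: filterS h => _ [k [[_ _ _ hk1] [_ _ _ hk2]] <-].
rewrite hr hs in hk1.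
exact: shift_eq_trans hk2 (shift_eqC hk1).
Qed.

End GroupoidTopology.

(** * Morphisms defined by cocycles *)

Section Cocycle.
Variables (E F : digraph) (h : bpath E -> bpath F) (c : bpath E -> int).
Implicit Types (x y z w : bpath E).

(** The value [c z] is the degree of an arrow from [h (shift z)] to [h z]; the
    exponents of its shift equation are locally constant, which makes this arrow
    depend continuously on [z]. *)
Definition continuous_cocycle := forall x, blen_ge 1 x -> exists l k : nat,
  \forall z \near x, c z = (l%:Z - k%:Z)%R /\ shift_eq l (h z) k (h (shift z)).

Definition cocycle_sum m x : int := (\sum_(i < m) c (iter i shift x))%R.

Lemma cocycle_sumS m x :
  cocycle_sum m.+1 x = (cocycle_sum m x + c (iter m shift x))%R.
Proof. by rewrite /cocycle_sum big_ord_recr. Qed.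

Lemma cocycle_sumD m n x :
  cocycle_sum (m + n) x = (cocycle_sum m x + cocycle_sum n (iter m shift x))%R.
Proof.
elim: n => [|n IH]; first by rewrite addn0 [cocycle_sum 0 _]big_ord0 addr0.
by rewrite addnS !cocycle_sumS IH addrA addnC iterD.
Qed.

(** Raising both exponents adds the same sum along the common tail to both sums. *)
Lemma cocycle_sum_shift_eq m n m' n' x y :
  shift_eq m x n y -> shift_eq m' x n' y -> (m%:Z - n%:Z = m'%:Z - n'%:Z)%R ->
  (cocycle_sum m x - cocycle_sum n y = cocycle_sum m' x - cocycle_sum n' y)%R.
Proof.
wlog mm : m n m' n' / m <= m' => [hw a b d|].
  by have [/hw|/ltnW/hw hw'] := leqP m m'; [exact|symmetry; apply: hw'].
move=> [_ _ e] _ d; have -> : n' = n + (m' - m) by lia.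
rewrite -{1}(subnKC mm) !cocycle_sumD e opprD.
by rewrite addrACA subrr addr0.
Qed.

(** The degree of the image of the arrow [(x, d, y)]: go [m] steps forward from [x],
    then [n] steps back to [y]. The choice of the exponents is immaterial by
    [cocycle_sum_shift_eq]. *)
Definition transfer x (d : int) y : int :=
  let mn := xget (0, 0) [set mn : nat * nat |
    d = (mn.1%:Z - mn.2%:Z)%R /\ shift_eq mn.1 x mn.2 y] in
  (cocycle_sum mn.1 x - cocycle_sum mn.2 y)%R.

Lemma transferE m n x y : shift_eq m x n y ->
  transfer x (m%:Z - n%:Z)%R y = (cocycle_sum m x - cocycle_sum n y)%R.
Proof.
move=> hmn; rewrite /transfer; set P := [set mn | _].
have [e1 e2] : P (xget (0, 0) P) by exact: (@xgetI _ _ _ (m, n)).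
exact: cocycle_sum_shift_eq.
Qed.

Lemma transferD x d y d' z : is_arrow (x, d, y) -> is_arrow (y, d', z) ->
  transfer x (d + d')%R z = (transfer x d y + transfer y d' z)%R.
Proof.
move=> [m [n [/= -> h1]]] [p [q [/= -> h2]]]; rewrite !transferE //.
have [_ _ e1] := h1; have [_ _ e2] := h2.
have -> : (m%:Z - n%:Z + (p%:Z - q%:Z) =
          (m + (p - n))%N%:Z - (q + (n - p))%N%:Z)%R by lia.
rewrite transferE; last exact: shift_eq_trans h1 h2.
rewrite !cocycle_sumD e1 -e2.
have : (cocycle_sum (n + (p - n)) y = cocycle_sum (p + (n - p)) y)%R.
  by congr cocycle_sum; lia.
rewrite !cocycle_sumD; lia.
Qed.

Lemma transferN x d y : is_arrow (x, d, y) ->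
  transfer y (- d)%R x = (- transfer x d y)%R.
Proof.
move=> [m [n [/= -> h1]]]; rewrite opprB !transferE ?opprB //.
exact: shift_eqC.
Qed.

Hypothesis cc : continuous_cocycle.

Lemma near_cocycle_sum m x : blen_ge m x -> exists l k : nat,
  \forall z \near x, cocycle_sum m z = (l%:Z - k%:Z)%R /\
                     shift_eq l (h z) k (h (iter m shift z)).
Proof.
elim: m => [|m IH].
  move=> _; exists 0, 0; apply: filterE => z; rewrite [cocycle_sum _ _]big_ord0.
  by split=> //; split=> //; exact: blen_ge0.
move=> /blen_geS_iter[h1 h2]; have [l [k hlk]] := IH h1.
have [l' [k' hlk']] := cc h2; have hlk'' := iter_shift_continuous h1 hlk'.
exists (l + (l' - k)), (k' + (k - l')); near=> z.
have [e1 s1] : cocycle_sum m z = (l%:Z - k%:Z)%R /\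
  shift_eq l (h z) k (h (iter m shift z)) by near: z.
have [e2 s2] : c (iter m shift z) = (l'%:Z - k'%:Z)%R /\
  shift_eq l' (h (iter m shift z)) k' (h (shift (iter m shift z))).
  by near: z.
rewrite cocycle_sumS e1 e2; split; first by lia.
exact: shift_eq_trans s1 s2.
Unshelve. all: by end_near. Qed.

Lemma near_transfer m n x y : shift_eq m x n y ->
  exists M N U V, [/\ nbhs x U, nbhs y V & forall z w, U z -> V w ->
    shift_eq m z n w -> transfer z (m%:Z - n%:Z)%R w = (M%:Z - N%:Z)%R /\
                        shift_eq M (h z) N (h w)].
Proof.
move=> [bx hy _]; have [l [k hx]] := near_cocycle_sum bx.
have [l' [k' hy']] := near_cocycle_sum hy.
exists (l + (k' - k)), (l' + (k - k')); do 2!eexists.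
split; [exact: hx|exact: hy'|].
move=> z w [e1 s1] [e2 s2] hzw; rewrite transferE // e1 e2.
split; first by lia.
have [_ _ e] := hzw; rewrite -e in s2.
exact: shift_eq_trans s1 (shift_eqC s2).
Qed.

Lemma transfer_arrow x d y :
  is_arrow (x, d, y) -> is_arrow (h x, transfer x d y, h y).
Proof.
move=> [m [n [/= -> hmn]]].
have [M [N [U [V [hU hV hUV]]]]] := near_transfer hmn.
have [-> ?] := hUV _ _ (nbhs_singleton hU) (nbhs_singleton hV) hmn.
exact: arrow_shift_eq.
Qed.

(** Near an arrow with exponents [m] and [n], the image is described by the fixed
    exponents of [near_transfer], whence continuity. *)
Lemma cocycle_morphism : continuous h ->
  exists phi : groupoid E -> groupoid F,
    [/\ continuous phi, groupoid_hom phi &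
        forall g, [/\ arng (phi g) = h (arng g),
          adeg (phi g) = transfer (arng g) (adeg g) (asrc g) &
          asrc (phi g) = h (asrc g)]].
Proof.
move=> hc.
pose phi g := Arrow (asboolT (transfer_arrow (is_arrowP g))).
have phiP g : [/\ arng (phi g) = h (arng g),
    adeg (phi g) = transfer (arng g) (adeg g) (asrc g) &
    asrc (phi g) = h (asrc g)] by [].
exists phi; split=> //.
- move=> g W hW; have [m [n [eg hg]]] := arrow_rep g.
  have [M [N [U [V [hU hV hUV]]]]] := near_transfer hg.
  have [ed hh] := hUV _ _ (nbhs_singleton hU) (nbhs_singleton hV) hg.
  have [||U' [V' [hU' hV' hW']]] := @arrow_set_nbhs _ (phi g) M N W _ _ hW.
  - by have [_ -> _] := phiP g; rewrite eg ed.
  - by have [-> _ ->] := phiP g.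
  apply: (@filterS _ (nbhs g) _
    (arrow_set (U `&` (h @^-1` U')) m n (V `&` (h @^-1` V')))).
    move=> k [[Uk Uk'] ek [Vk Vk'] hk].
    have [e1 e2] := hUV _ _ Uk Vk hk.
    apply: hW'; have [p1 p2 p3] := phiP k.
    by split; rewrite ?p1 ?p2 ?p3 // ek.
  apply: nbhs_arrow_set => //; apply: filterI => //; exact: hc.
- split=> [g g' gh|g].
    have gh' : composable (phi g) (phi g') by exact: (congr1 h gh).
    exists gh'; apply: arrow_eq => //.
    have e : asrc g = arng g' := gh; have gP := is_arrowP g; rewrite e in gP.
    transitivity (adeg (phi g) + adeg (phi g'))%R => //.
    have [_ -> _] := phiP g; have [_ -> _] := phiP g'; rewrite e.
    exact: transferD (is_arrowP g').
  by apply: arrow_eq => //; exact: transferN (is_arrowP g).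
Qed.

End Cocycle.

Lemma open_blen_ge (E : digraph) n : open (blen_ge n : set (bpath E)).
Proof. by rewrite openE => x; exact: near_blen. Qed.

Lemma shift_cocycles_continuous_cocycle (E F : digraph)
    (h : bpath E -> bpath F) :
  shift_cocycles h -> exists c, continuous_cocycle h c.
Proof.
move=> [k [l [kc lc hkl]]]; exists (fun x => (l x)%:Z - (k x)%:Z)%R => x hx.
exists (l x), (k x).
have near_const (f : bpath E -> nat) : {within blen_ge 1, continuous f} ->
    \forall z \near x, f z = f x.
  rewrite continuous_open_subspace; last exact: open_blen_ge.
  move=> hf; exact: (hf x (mem_set hx) _ (discrete_set1 (f x))).
have kx := near_const _ kc; have lx := near_const _ lc; have bx := near_blen hx.
near=> z.
have ek : k z = k x by near: z.
have el : l z = l x by near: z.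
rewrite ek el; split=> //; rewrite -ek -el; apply: shift_eqC.
by apply: hkl; near: z.
Unshelve. all: by end_near. Qed.

(** * Isolated periodic paths *)

Section Isotropy.
Variable E : digraph.
Implicit Types (x y r : bpath E).

Lemma is_arrow_mul x d (k : int) :
  is_arrow (x, d, x) -> is_arrow (x, k * d, x)%R.
Proof.
move=> hd; have hn (n : nat) : is_arrow (x, n%:Z * d, x)%R.
  elim: n => [|n IH]; first by rewrite mul0r; exact: is_arrow_refl.
  by rewrite intS mulrDl mul1r; exact: is_arrow_trans hd IH.
by case: k => n //; rewrite NegzE mulNr; exact: is_arrow_sym.
Qed.

Definition isotropy_generator x (q : nat) : Prop :=
  0 < q /\ forall d : int, is_arrow (x, d, x) <-> (Posz q %| d)%Z.

Lemma isotropy_generator_exists x :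
  eventually_periodic x -> exists q, isotropy_generator x q.
Proof.
move=> /eventually_periodicP[c c0 hc].
have exP : exists q, (0 < q) && `[< is_arrow (x, Posz q, x) >].
  exists `|c|%N; rewrite absz_gt0 c0; apply/asboolP.
  case: (intP c) hc => [||] // n; rewrite abszN => /is_arrow_sym.
  by rewrite opprK.
have [q /andP[q0 /asboolP hq] qmin] := ex_minnP exP.
exists q; split=> // d; split=> [hd|/dvdzP[k ->]]; last exact: is_arrow_mul.
have : is_arrow (x, (d %% Posz q)%Z, x).
  have -> : ((d %% Posz q)%Z = d + - ((d %/ Posz q)%Z * Posz q))%R.
    by rewrite {2}(divz_eq d (Posz q)) addrC addrA addNr add0r.
  by apply: is_arrow_trans hd _; apply: is_arrow_sym; exact: is_arrow_mul.
have qn0 : Posz q != 0%R by rewrite eqz_nat -lt0n.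
have := modz_ge0 d qn0; have : ((d %% Posz q)%Z < Posz q)%R by rewrite ltz_pmod.
move=> lt ge har; apply/dvdz_mod0P; move: lt ge har.
case: (d %% Posz q)%Z => [[|r]|r] // lt _ har.
by have := qmin r.+1; rewrite asboolT //= => /(_ isT); lia.
Qed.

Definition isotropy_order x : nat := xget 0 (isotropy_generator x).

Lemma isotropy_orderP x :
  eventually_periodic x -> isotropy_generator x (isotropy_order x).
Proof. by move=> hx; apply: xgetPex; exact: isotropy_generator_exists. Qed.

(** The shift equation of the arrow can be followed to the end of a turn around
    the cycle, where it starts from [x] itself. *)
Lemma iter_shift_arrow s p x : 0 < s -> iter s shift x = x ->
  is_arrow (x, p%:Z, x)%R -> iter p shift x = x.
Proof.
move=> s0 hs [m [n [/= ep [_ _ e]]]].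
have em : m = n + p by lia.
have nns : n <= n * s by exact: leq_pmulr.
have := congr1 (iter (n * s - n) shift) e.
by rewrite -!iterD em addnA subnK // addnC iterD iter_period.
Qed.

Definition isolated_periodic x : Prop :=
  [/\ infinite_path x, nbhs x [set x] & exists2 p, 0 < p & iter p shift x = x].

Lemma isolated_periodic_shift x :
  isolated_periodic x -> isolated_periodic (shift x).
Proof.
move=> [ix nx [p p0 hp]].
have b1 := (infinite_pathP x).1 ix 1; split.
- apply/infinite_pathP => m; have := (infinite_pathP x).1 ix m.+1.
  by case/blen_geS.
- by have := shift_open b1 nx; rewrite image_set1.
- by exists p => //; rewrite -iterSr iterS hp.
Qed.

Lemma isolated_periodic_iter i x :
  isolated_periodic x -> isolated_periodic (iter i shift x).
Proof. by move=> hx; elim: i => //= i; exact: isolated_periodic_shift. Qed.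

Lemma isolated_eventually_periodic_iter x : isolated_eventually_periodic E x ->
  exists n, isolated_periodic (iter n shift x).
Proof.
move=> [[ix [n [p [p0 [_ bn e]]]]] /open_set1 nx]; exists n; split.
- apply/infinite_pathP => m; have := (infinite_pathP x).1 ix (n + m).
  by case/blen_geD.
- by have := iter_shift_open bn nx; rewrite image_set1.
- by exists p => //; rewrite -iterD addnC.
Qed.

Lemma isolated_periodicW x :
  isolated_periodic x -> isolated_eventually_periodic E x.
Proof.
move=> [ix nx [p p0 hp]]; split; last exact/open_set1.
split=> //; exists 0, p; split=> //.
by split; rewrite ?add0n //; exact: (infinite_pathP x).1.
Qed.

(** For a periodic path this choice depends on the cycle only, because the set of
    iterated shifts does. *)
Definition cycle_base x := xget x [set y | exists i, y = iter i shift x].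

Lemma cycle_base_iter x : exists i, cycle_base x = iter i shift x.
Proof.
by apply: (@xgetPex _ x [set y | exists i, y = iter i shift x]); exists x, 0.
Qed.

Lemma xget_default (T : choiceType) (P : set T) (a b : T) :
  P !=set0 -> xget a P = xget b P.
Proof.
move=> [t Pt]; rewrite /xget; case: pselect => // -[].
by exists t; exact/asboolP.
Qed.

Lemma cycle_base_shift x :
  isolated_periodic x -> cycle_base (shift x) = cycle_base x.
Proof.
move=> [_ _ [p p0 hp]]; rewrite /cycle_base.
have -> : [set y | exists i, y = iter i shift (shift x)] =
          [set y | exists i, y = iter i shift x].
  apply/seteqP; split=> y /= [i ->]; first by exists i.+1; rewrite iterSr.
  by exists (i + p.-1); rewrite -iterSr -addnS prednK // iterD hp.
by apply: xget_default; exists x; exists 0.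
Qed.

Lemma cycle_base_iterE i x :
  isolated_periodic x -> cycle_base (iter i shift x) = cycle_base x.
Proof.
move=> hx; elim: i => //= i IH; rewrite cycle_base_shift //.
exact: isolated_periodic_iter.
Qed.

Definition is_cycle_base x : Prop := isolated_periodic x /\ cycle_base x = x.

Lemma is_cycle_base_exists x : isolated_eventually_periodic E x ->
  exists t r, is_cycle_base r /\ is_arrow (x, t, r).
Proof.
move=> hx; have [n hn] := isolated_eventually_periodic_iter hx.
have [i hi] := cycle_base_iter (iter n shift x).
exists ((n + i)%N%:Z - 0)%R, (cycle_base (iter n shift x)); split.
  split; first by rewrite hi; exact: isolated_periodic_iter.
  by rewrite [in LHS]hi cycle_base_iterE.
rewrite hi; apply: (@arrow_shift_eq _ _ _ 0); split.
- by case: hx => -[ix _] _; exact: (infinite_pathP x).1.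
- exact: blen_ge0.
- by rewrite addnC iterD.
Qed.

(** A cycle base is the only path that begins with its first edge. Hence cycle
    bases do not accumulate at paths of positive length, and a cocycle may be
    changed at all of them without losing continuity. *)
Lemma near_not_cycle_base x : blen_ge 1 x -> ~ is_cycle_base x ->
  \forall z \near x, ~ is_cycle_base z.
Proof.
move=> /blen_ge1P[e he] nx; apply: filterS (near_bhead he) => z hz [].
move=> [iz nz [p p0 hp]] rz; apply: nx.
have <- : z = x.
  by symmetry; apply: isolated_periodic_bhead hp _ => //; rewrite he hz.
by split=> //; split=> //; exists p.
Qed.

End Isotropy.

(** * Correcting a cocycle on isotropy groups *)

Section Correction.
Variables (E F : digraph) (h : bpath E -> bpath F) (c : bpath E -> int).
Implicit Types (x y z w r : bpath E).
Hypothesis cc : continuous_cocycle h c.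
Hypothesis hper : forall x,
  isolated_eventually_periodic E x -> eventually_periodic (h x).

(** The value at the base of a cycle is the one for which a full turn around the
    cycle has as its degree the generator of the isotropy group of the image. *)
Definition corrected_cocycle x : int :=
  if `[< is_cycle_base x >]
  then ((isotropy_order (h x))%:Z -
        cocycle_sum c (isotropy_order x).-1 (shift x))%R
  else c x.

Lemma cycle_base_order r : is_cycle_base r ->
  isotropy_generator r (isotropy_order r) /\
  isotropy_generator (h r) (isotropy_order (h r)).
Proof.
move=> [hr _]; have Ir := isolated_periodicW hr.
by split; apply: isotropy_orderP; [case: Ir|exact: hper].
Qed.

Lemma iter_order r : is_cycle_base r -> iter (isotropy_order r) shift r = r.
Proof.
move=> hr; have [[p0 hp] _] := cycle_base_order hr.
have [[_ _ [s s0 hs]] _] := hr.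
by apply: (iter_shift_arrow s0 hs); apply/hp.
Qed.

(** A full turn from a cycle base meets the corrected value only at its start. *)
Lemma corrected_cocycle_sum r : is_cycle_base r ->
  cocycle_sum corrected_cocycle (isotropy_order r) r =
  (isotropy_order (h r))%:Z%R.
Proof.
move=> hr; have [[p0 hp] _] := cycle_base_order hr.
have [ir _ _] := hr.1.
rewrite -{1}(prednK p0) -add1n cocycle_sumD /=.
have -> : cocycle_sum corrected_cocycle (isotropy_order r).-1 (shift r) =
          cocycle_sum c (isotropy_order r).-1 (shift r).
  apply: eq_bigr => i _; rewrite /corrected_cocycle asboolF // -iterSr => hi.
  have hir : iter i.+1 shift r = r.
    by rewrite -[LHS]hi.2 cycle_base_iterE ?hr.2 //; case: hr.
  have : is_arrow (r, (i.+1)%:Z - 0%N%:Z, r)%R.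
    apply: arrow_shift_eq; split=> //; first exact: (infinite_pathP r).1.
    exact: blen_ge0.
  rewrite subr0 => /hp; rewrite dvdzE /= => /dvdn_leq; have := ltn_ord i; lia.
rewrite /cocycle_sum big_ord1 /= /corrected_cocycle asboolT //.
by rewrite subrK.
Qed.

Lemma corrected_cocycle_continuous : continuous_cocycle h corrected_cocycle.
Proof.
move=> x bx; have [hx|nx] := pselect (is_cycle_base x).
  have [[p0 hp] [q0 hq]] := cycle_base_order hx.
  have [[ix nx _] _] := hx.
  have bsx : blen_ge (isotropy_order x).-1 (shift x).
    have := (infinite_pathP x).1 ix (isotropy_order x).-1.+1.
    by case/blen_geS.
  have : is_arrow (h x, corrected_cocycle x, h (shift x)).
    rewrite /corrected_cocycle asboolT //.
    apply: (is_arrow_trans (y := h x)); first exact/hq.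
    have [l [k /nbhs_singleton[-> s]]] := near_cocycle_sum cc bsx.
    apply: is_arrow_sym; apply: arrow_shift_eq; move: s.
    by rewrite -iterSr prednK // iter_order.
  move=> [l [k [/= el hl]]]; exists l, k.
  by apply: filterS nx => z ->.
have [l [k hlk]] := cc bx; exists l, k.
have hn := near_not_cycle_base bx nx.
apply: filterS2 hlk hn => z [el hl] nz; split=> //.
by rewrite /corrected_cocycle asboolF.
Qed.

Lemma corrected_transfer_base r (k : int) : is_cycle_base r ->
  transfer corrected_cocycle r (k * (isotropy_order r)%:Z)%R r =
  (k * (isotropy_order (h r))%:Z)%R.
Proof.
move=> hr; have [[p0 hp] [q0 hq]] := cycle_base_order hr.
have har (j : int) : is_arrow (r, j * (isotropy_order r)%:Z, r)%R.
  by apply/hp; exact: dvdz_mull.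
have h1 : transfer corrected_cocycle r (isotropy_order r)%:Z%R r =
          (isotropy_order (h r))%:Z%R.
  have sr : shift_eq (isotropy_order r) r 0 r.
    have [[ir _ _] _] := hr.
    split; [exact: (infinite_pathP r).1|exact: blen_ge0|exact: iter_order].
  have := transferE corrected_cocycle sr; rewrite subr0 => ->.
  by rewrite corrected_cocycle_sum // [cocycle_sum _ 0 _]big_ord0 subr0.
have hn (n : nat) :
  transfer corrected_cocycle r (n%:Z * (isotropy_order r)%:Z)%R r =
  (n%:Z * (isotropy_order (h r))%:Z)%R.
  elim: n => [|n IH].
    have sr : shift_eq 0 r 0 r by split=> //; exact: blen_ge0.
    have := transferE corrected_cocycle sr.
    by rewrite subr0 !mul0r [cocycle_sum _ 0 _]big_ord0 subr0.
  rewrite intS !mulrDl !mul1r (transferD _ (y := r)) ?h1 ?IH //.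
  by have := har 1%R; rewrite mul1r.
case: k => n; first exact: hn.
by rewrite NegzE !mulNr transferN ?hn.
Qed.

(** Conjugating by an arrow to a cycle base [r] reduces this and the next lemma to
    the isotropy group of [r], where generator goes to generator. *)
Lemma corrected_transfer_inj x d : isolated_eventually_periodic E x ->
  is_arrow (x, d, x) -> transfer corrected_cocycle x d x = 0%R -> d = 0%R.
Proof.
move=> Ix hd; have [t [r [hr ht]]] := is_cycle_base_exists Ix.
have [[p0 hp] [q0 hq]] := cycle_base_order hr.
have ht' := is_arrow_sym ht.
have hdt := is_arrow_trans hd ht; have hall := is_arrow_trans ht' hdt.
have := transferD corrected_cocycle ht' hdt.
rewrite (transferD _ hd ht) (transferN _ ht) => e h0.
have {e} : transfer corrected_cocycle r d r = 0%R.
  by move: e; rewrite h0 add0r addNr addrCA addNr addr0.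
have := hall; rewrite addrCA addNr addr0 => /hp/dvdzP[k ->].
rewrite corrected_transfer_base // => /eqP; rewrite mulf_eq0.
by case/orP => /eqP; [move=> ->; rewrite mul0r|lia].
Qed.

Lemma corrected_transfer_surj x d : isolated_eventually_periodic E x ->
  is_arrow (h x, d, h x) ->
  exists2 d', is_arrow (x, d', x) & transfer corrected_cocycle x d' x = d.
Proof.
move=> Ix hd; have [t [r [hr ht]]] := is_cycle_base_exists Ix.
have [[p0 hp] [q0 hq]] := cycle_base_order hr.
have ht' := is_arrow_sym ht.
have hT := transfer_arrow corrected_cocycle_continuous ht.
have := is_arrow_trans (is_arrow_sym hT) (is_arrow_trans hd hT).
rewrite addrCA addNr addr0 => /hq/dvdzP[k ek].
have hk : is_arrow (r, k * (isotropy_order r)%:Z, r)%R.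
  by apply/hp; exact: dvdz_mull.
have hkt := is_arrow_trans hk ht'.
exists (t + (k * (isotropy_order r)%:Z - t))%R.
  exact: is_arrow_trans ht hkt.
rewrite (transferD _ ht hkt) (transferD _ hk ht') (transferN _ ht).
by rewrite corrected_transfer_base // -ek addrCA subrr addr0.
Qed.

End Correction.

(** * Locally constant selections *)

Section Selection.
Variable E : digraph.
Implicit Types (x y z w : bpath E).

(** If [mu] starts with an edge [e] that does not start [x], then [x] lies in the
    open set of paths from [src e] that do not start with [e], even if [x] has
    length [0]. *)
Lemma near_not_cylinder mu x : is_path mu -> ~ cylinder mu x ->
  \forall z \near x, ~ cylinder mu z.
Proof.
case: mu => v s; elim: s v x => [|e s IH] v x hmu nx.
  apply: filterS (near_bsrc x) => z hz /cylinder_nil hv.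
  by apply: nx; apply/cylinder_nil; rewrite -hz.
have /andP[/= /eqP hv hs] := hmu; rewrite -{}hv in hmu nx *.
have [hx|hx] := pselect (bhead x = Some e).
  have b1 : blen_ge 1 x by apply/blen_ge1P; exists e.
  have nsx : ~ cylinder (rng e, s) (shift x).
    by move=> hs'; apply: nx; apply/cylinder_cons.
  have hn : \forall z \near x, ~ cylinder (rng e, s) (shift z).
    exact: shift_continuous b1 _ (IH _ _ hs nsx).
  by apply: filterS hn => z hz /cylinder_cons[].
have [sx|sx] := eqVneq (bsrc x) (src e); last first.
  apply: filterS (near_bsrc x) => z hz /cylinder_cons[/bhead_src hz'] _.
  by rewrite -hz hz' eqxx in sx.
have : nbhs x (cylinderD (src e, [::]) [set e]).
  apply: open_nbhs_nbhs; split.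
    apply: open_bpath_basis; exists (src e, [::]), [set e]; split=> //.
    by move=> _ ->.
  split; first exact/cylinder_nil.
  by move=> [_ -> /cylinder_cons[]].
apply: filterS => z [_ hz] /cylinder_cons[hze _]; apply: hz; exists e => //.
by apply/cylinder_cons; split=> //; exact/cylinder_nil/bsrc_shift.
Qed.

Lemma near_cylinder mu x : is_path mu ->
  \forall z \near x, `[< cylinder mu z >] = `[< cylinder mu x >].
Proof.
move=> hmu; have [hx|hx] := pselect (cylinder mu x).
  have : nbhs x (cylinder mu).
    by apply: open_nbhs_nbhs; split=> //; exact: cylinder_open.
  by apply: filterS => z hz; rewrite !asboolT.
by apply: filterS (near_not_cylinder hmu hx) => z hz; rewrite !asboolF.
Qed.

(** These tests define a basis of clopen sets that is indexed by a countable
    type. *)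
Definition cylinder_test (s : seq (bool * prepath E)) z : bool :=
  all (fun t => is_path t.2 ==> (`[< cylinder t.2 z >] == t.1)) s.

Lemma near_cylinder_test s x :
  \forall z \near x, cylinder_test s z = cylinder_test s x.
Proof.
elim: s => [|[b mu] s IH]; first exact: filterE.
have [hmu|/negbTE hmu] := boolP (is_path mu).
  by apply: filterS2 (near_cylinder x hmu) IH => z h1 h2; rewrite /cylinder_test /= h1; congr andb.
by apply: filterS IH => z hz; rewrite /cylinder_test /= hmu.
Qed.

Lemma walk_rcons v s (f : edge E) :
  walk v (rcons s f) = walk v s && (src f == last v (map (@rng E) s)).
Proof. by elim: s v => [|e s IH] v /=; [rewrite andbT|rewrite IH andbA]. Qed.

Lemma nbhs_cylinder_test x U : nbhs x U ->
  exists2 s, cylinder_test s x & forall z, cylinder_test s z -> U z.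
Proof.
pose F : set_system (bpath E) :=
  filter_from [set s | cylinder_test s x] (fun s => [set z | cylinder_test s z]).
have FF : Filter F.
  apply: filter_from_filter; first by exists [::].
  move=> s t hs ht; exists (s ++ t); first by rewrite /= /cylinder_test all_cat; apply/andP.
  by move=> z /=; rewrite /cylinder_test all_cat => /andP[].
suff Fx : F --> x by move=> /Fx[s hs hU]; exists s.
apply: (nbhs_bpath_filter FF) => B [mu [A [hmu /finite_seqP[a ->] sA ->]]] hB.
have hp f : f \in a -> is_path (path_rcons mu f).
  move=> fa; rewrite /is_path /path_rcons /= walk_rcons; apply/andP; split=> //.
  by apply/eqP; exact: (sA f fa).
exists ((true, mu) :: [seq (false, path_rcons mu f) | f <- a]).
  rewrite /= /cylinder_test /= asboolT ?implybT /=; last by case: hB.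
  apply/allP => _ /mapP[f fa ->] /=; apply/implyP => _; rewrite asboolF //.
  by move=> hf; case: hB => _; apply; exists f.
move=> z /=; rewrite /cylinder_test /= hmu /= eqb_id => /andP[/asboolP hz].
move=> /allP ha; split=> // -[f fa hf].
have := ha (false, path_rcons mu f) (map_f _ fa); rewrite /= hp //.
by rewrite asboolT.
Qed.

(** The clopen basic sets are countably many, so a value can be selected according
    to the first of them that contains [x] and admits a common value for all its
    points; clopenness keeps this index locally constant. *)
Lemma locally_constant_selection (T : choiceType) (t0 : T)
    (D : set (bpath E)) (P : bpath E -> T -> Prop) :
  (forall x, D x -> exists t, \forall z \near x, P z t) ->
  exists f : bpath E -> T,
    forall x, D x -> P x (f x) /\ \forall z \near x, f z = f x.
Proof.
move=> hP.
pose test i := odflt [::] (unpickle i : option (seq (bool * prepath E))).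
pose good i t := forall z, cylinder_test (test i) z -> P z t.
pose Q z i := cylinder_test (test i) z && `[< exists t, good i t >].
pose first z := if pselect (exists i, Q z i) is left e then ex_minn e else 0.
have firstP z i : Q z i -> Q z (first z) /\ forall j, Q z j -> first z <= j.
  move=> hi; rewrite /first; case: pselect => [e|[]]; last by exists i.
  by case: ex_minnP.
have nearQ x n : \forall z \near x, forall j, j < n -> Q z j = Q x j.
  elim: n => [|n IH]; first exact: filterE.
  apply: filterS2 IH (near_cylinder_test (test n) x) => z h1 h2 j.
  by rewrite ltnS leq_eqVlt => /orP[/eqP ->|/h1 //]; rewrite /Q h2.
exists (fun z => xget t0 (good (first z))) => x Dx.
have [t /nbhs_cylinder_test[s hs hst]] := hP x Dx.
have ts : test (pickle s) = s by rewrite /test pickleK.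
have Qx : Q x (pickle s).
  by rewrite /Q ts hs; apply/asboolP; exists t; rewrite /good ts.
have [Qf fmin] := firstP _ _ Qx; split.
  by have /andP[h1 /asboolP h2] := Qf; exact: (xgetPex t0 h2).
apply: filterS (nearQ x (first x).+1) => z hz.
suff -> : first z = first x by [].
have Qzf : Q z (first x) by rewrite hz.
have [Qz zmin] := firstP _ _ Qzf; have le := zmin _ Qzf.
by apply/eqP; rewrite eqn_leq le fmin // -hz.
Qed.

End Selection.

(** * From isomorphisms to orbit equivalences *)

(** The image of the arrow from [shift x] to [x] has a shift equation for its ends,
    which remains valid near [x] because [phi] is continuous. *)
Lemma continuous_over_shift_cocycles (E F : digraph)
    (phi : groupoid E -> groupoid F) (h : bpath E -> bpath F) :
  continuous phi -> (forall g, arng (phi g) = h (arng g)) ->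
  (forall g, asrc (phi g) = h (asrc g)) -> shift_cocycles h.
Proof.
move=> phic hr hs.
pose P x (lk : nat * nat) := shift_eq lk.2 (h (shift x)) lk.1 (h x).
have [|f hf] := @locally_constant_selection E _ (0, 0) (blen_ge 1) P.
  move=> x bx.
  have harr (z : bpath E) : blen_ge 1 z -> is_arrow (z, 1%:Z - 0%N%:Z, shift z)%R.
    by move=> bz; apply: arrow_shift_eq; split=> //; exact: blen_ge0.
  have [g [g1 g2 g3]] := arrow_of (harr x bx).
  have [l [k [e hlk]]] := arrow_rep (phi g); exists (l, k).
  have hW : nbhs g (phi @^-1` arrow_set setT l k setT).
    by apply: phic; apply: nbhs_arrow_set => //; exact: filterT.
  have := @near_shift_arrow _ g _ _ _ _ hW; rewrite g1 => /(_ bx g2 g3) hn.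
  apply: filterS2 hn (near_blen bx) => z hz bz.
  have [g' [e1 e2 e3]] := arrow_of (harr z bz).
  have [_ _ _] := hz _ e1 e2 e3.
  by rewrite hr hs e1 e3; exact: shift_eqC.
have fc (T : topologicalType) (p : nat * nat -> T) :
    {within blen_ge 1, continuous (fun x => p (f x))}.
  rewrite continuous_open_subspace; last exact: open_blen_ge.
  move=> x /set_mem bx U hU; have [_ hx] := hf x bx.
  apply: (@filterS _ (nbhs x) _ _ _ _ hx) => z /= ->.
  exact: nbhs_singleton hU.
exists (fun x => (f x).2), (fun x => (f x).1); split; [exact: fc snd|exact: fc fst|].
by move=> x bx; have [] := hf x bx.
Qed.

Section Induced.
Variables (E F : digraph) (phi : groupoid E -> groupoid F).
Hypothesis hom : groupoid_hom phi.

Definition induced_map x := arng (phi (aunit x)).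

(** The image of a unit is idempotent, hence a unit. *)
Lemma hom_aunit x : phi (aunit x) = aunit (induced_map x).
Proof.
have [gh e] := hom.1 (aunit x) (aunit x) (erefl x).
have u : amul (erefl x : composable (aunit x) (aunit x)) = aunit x.
  by apply: arrow_eq => //; rewrite /adeg /= addr0.
rewrite u in e; apply: arrow_eq; [by []| |exact: gh].
have d : (adeg (phi (aunit x)) = adeg (phi (aunit x)) + adeg (phi (aunit x)))%R.
  by have := congr1 (@adeg F) e.
by apply: (@addrI _ (adeg (phi (aunit x)))); rewrite -d addr0.
Qed.

Lemma hom_arng g : arng (phi g) = induced_map (arng g).
Proof.
have [gh _] := hom.1 (aunit (arng g)) g (erefl _).
by rewrite -[LHS]gh hom_aunit.
Qed.

Lemma hom_asrc g : asrc (phi g) = induced_map (asrc g).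
Proof.
have [gh _] := hom.1 g (aunit (asrc g)) (erefl _).
by rewrite [LHS]gh hom_aunit.
Qed.

Lemma induced_map_continuous : continuous phi -> continuous induced_map.
Proof.
move=> phic x; apply: (@continuous_comp _ _ _ (@aunit E) (fun g => arng (phi g))).
  exact: aunit_continuous.
by apply: (@continuous_comp _ _ _ phi (@arng F)); [exact: phic|exact: arng_continuous].
Qed.

End Induced.

Lemma induced_map_cancel (E F : digraph) (phi : groupoid E -> groupoid F)
    (psi : groupoid F -> groupoid E) :
  groupoid_hom phi -> groupoid_hom psi -> cancel phi psi ->
  cancel (induced_map phi) (induced_map psi).
Proof.
by move=> hp hq can x; rewrite /induced_map -/(induced_map phi x) -hom_aunit // can.
Qed.

(** Eventual periodicity means nontrivial isotropy, which an injective morphism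
    preserves. *)
Lemma induced_map_isolated (E F : digraph) (phi : groupoid E -> groupoid F)
    (g : bpath F -> bpath E) x :
  groupoid_hom phi -> injective phi -> continuous g ->
  cancel (induced_map phi) g -> cancel g (induced_map phi) ->
  isolated_eventually_periodic E x ->
  isolated_eventually_periodic F (induced_map phi x).
Proof.
move=> hp inj gc can1 can2 [/eventually_periodicP[d d0 hd] ox]; split.
  have [k [k1 k2 k3]] := arrow_of hd.
  apply/eventually_periodicP; exists (adeg (phi k)).
    apply: contra_neq d0 => e; rewrite -k2.
    suff -> : k = aunit x by [].
    apply: inj; rewrite hom_aunit //; apply: arrow_eq => //.
      by rewrite hom_arng // k1.
    by rewrite hom_asrc // k3.
  by have := is_arrowP (phi k); rewrite hom_arng // hom_asrc // k1 k3.
have := open_comp (f := g) (D := [set x]) (fun y _ => gc y) ox.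
suff -> : g @^-1` [set x] = [set induced_map phi x] by [].
by apply/seteqP; split=> y /= => [<-|->]; rewrite ?can2 ?can1.
Qed.

Lemma iso_orbit_equivalence (E F : digraph) (phi : groupoid E -> groupoid F) :
  groupoid_iso phi ->
  [/\ unique (induces phi) (induced_map phi),
      orbit_equivalence (induced_map phi) &
      preserves_isolated_eventually_periodic (induced_map phi)].
Proof.
move=> [psi [[can1 can2 phic psic] hp hq]].
have hcan1 := induced_map_cancel hp hq can1.
have hcan2 := induced_map_cancel hq hp can2.
have hc := induced_map_continuous phic.
have gc := induced_map_continuous psic.
have inv : inverse_homeomorphisms (induced_map phi) (induced_map psi) by [].
split.
- split; first by split; [exists (induced_map psi)|exact: hom_aunit].
  by move=> h' [_ hh]; apply/funext => x; rewrite /induced_map hh.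
- exists (induced_map psi); split=> //.
    by apply: (continuous_over_shift_cocycles phic) => g; [exact: hom_arng|exact: hom_asrc].
  by apply: (continuous_over_shift_cocycles psic) => g; [exact: hom_arng|exact: hom_asrc].
- apply/seteqP; split=> [_ [x Ix <-]|y Iy].
    exact: (induced_map_isolated hp (can_inj can1) gc).
  exists (induced_map psi y) => //.
  exact: (induced_map_isolated hq (can_inj can2) hc).
Qed.

(** * From orbit equivalences to isomorphisms *)

Lemma inverse_hom (E F : digraph) (phi : groupoid E -> groupoid F)
    (psi : groupoid F -> groupoid E) (h : bpath E -> bpath F) :
  groupoid_hom phi -> cancel phi psi -> cancel psi phi -> injective h ->
  (forall g, arng (phi g) = h (arng g)) -> (forall g, asrc (phi g) = h (asrc g)) ->
  groupoid_hom psi.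
Proof.
move=> hp can1 can2 hinj hr hs; split=> [g g' gg|g].
- have gg' : composable (psi g) (psi g').
    by apply: hinj; rewrite -hr -hs !can2.
  exists gg'; apply: (can_inj can1); rewrite can2.
  have [c ->] := hp.1 _ _ gg'.
  by apply: arrow_eq; rewrite /= /arng /adeg /asrc /= ?can2.
- by apply: (can_inj can1); rewrite can2 hp.2 can2.
Qed.

(** The corrected cocycle of [h] defines [phi], and any cocycle of the inverse of
    [h] defines a morphism [psi0] in the other direction. Both composites lie over
    the identity, hence fix every arrow whose range is not an isolated eventually
    periodic point. The remaining arrows differ by isotropy from arrows that
    [psi0] provides, and on isotropy [phi] is bijective by the correction. *)
Lemma orbit_equivalence_iso (E F : digraph) (h : bpath E -> bpath F) :
  orbit_equivalence h -> preserves_isolated_eventually_periodic h ->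
  exists phi : groupoid E -> groupoid F, groupoid_iso phi /\ induces phi h.
Proof.
move=> [g [[hg gh hc gc] ch cg]] hI.
have [c cc] := shift_cocycles_continuous_cocycle ch.
have [b bb] := shift_cocycles_continuous_cocycle cg.
have Ih x : isolated_eventually_periodic E x -> isolated_eventually_periodic F (h x).
  by move=> Ix; rewrite -hI; exists x.
have hI' x : isolated_eventually_periodic F (h x) -> isolated_eventually_periodic E x.
  by rewrite -hI => -[y Iy /(can_inj hg) <-].
have hper x Ix := (Ih x Ix).1.
have [phi [phic hphi phiP]] := cocycle_morphism (corrected_cocycle_continuous cc hper) hc.
have [psi0 [psic _ psiP]] := cocycle_morphism bb gc.
have fixE k : ~ isolated_eventually_periodic E (arng k) -> psi0 (phi k) = k.
  apply: (@continuous_over_id _ (psi0 \o phi)) => [|k'|k'] /=.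
  - by apply: continuous_comp; [exact: phic|exact: psic].
  - by have [-> _ _] := psiP (phi k'); have [-> _ _] := phiP k'.
  - by have [_ _ ->] := psiP (phi k'); have [_ _ ->] := phiP k'.
have fixF k : ~ isolated_eventually_periodic F (arng k) -> phi (psi0 k) = k.
  apply: (@continuous_over_id _ (phi \o psi0)) => [|k'|k'] /=.
  - by apply: continuous_comp; [exact: psic|exact: phic].
  - by have [-> _ _] := phiP (psi0 k'); have [-> _ _] := psiP k'.
  - by have [_ _ ->] := phiP (psi0 k'); have [_ _ ->] := psiP k'.
have inj : injective phi.
  move=> k k' e; have [p1 p2 p3] := phiP k; have [q1 q2 q3] := phiP k'.
  have er : arng k = arng k' by apply: (can_inj hg); rewrite -p1 -q1 e.
  have es : asrc k = asrc k' by apply: (can_inj hg); rewrite -p3 -q3 e.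
  have [Ik|nk] := pselect (isolated_eventually_periodic E (arng k)); last first.
    by rewrite -(fixE k nk) e fixE // -er.
  apply: arrow_eq => //; apply/eqP; rewrite -subr_eq0; apply/eqP.
  have ak := is_arrowP k; have := is_arrowP k'; rewrite -er -es => ak'.
  apply: (corrected_transfer_inj (c := c) hper Ik).
    exact: is_arrow_trans ak (is_arrow_sym ak').
  rewrite (transferD _ ak (is_arrow_sym ak')) (transferN _ ak').
  by rewrite -p2 e q2 -er -es subrr.
have surj k : exists k', phi k' = k.
  have [Ik|nk] := pselect (isolated_eventually_periodic F (arng k)); last first.
    by exists (psi0 k); exact: fixF.
  set k0 := psi0 k; have [e1 _ e3] := psiP k; have [p1 p2 p3] := phiP k0.
  have a0 := is_arrowP k0.
  have r0 : h (arng k0) = arng k by rewrite e1 gh.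
  have s0 : h (asrc k0) = asrc k by rewrite e3 gh.
  have I0 : isolated_eventually_periodic E (arng k0) by apply: hI'; rewrite r0.
  have T0 := transfer_arrow (corrected_cocycle_continuous cc hper) a0.
  have := is_arrowP k; rewrite -r0 -s0 => ak.
  have [d hd hdT] := corrected_transfer_surj cc hper I0 (is_arrow_trans ak (is_arrow_sym T0)).
  have [k1 [k1r k1d k1s]] := arrow_of (is_arrow_trans hd a0).
  exists k1.
  have [f1 f2 f3] := phiP k1; apply: arrow_eq.
  - by rewrite f1 k1r.
  - by rewrite f2 k1r k1d k1s (transferD _ hd a0) hdT subrK.
  - by rewrite f3 k1s.
pose psi k := sval (cid (surj k)).
have can2 : cancel psi phi by move=> k; rewrite /psi; case: cid.
have can1 : cancel phi psi by move=> k; apply: inj; rewrite can2.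
have hr k : arng (phi k) = h (arng k) by have [] := phiP k.
have hs k : asrc (phi k) = h (asrc k) by have [] := phiP k.
exists phi; split; last first.
  split; first by exists g.
  move=> x; apply: arrow_eq; rewrite ?hr ?hs //.
  have [_ -> _] := phiP (aunit x).
  have s0 : shift_eq 0 x 0 x by split=> //; exact: blen_ge0.
  by have := transferE (corrected_cocycle h c) s0; rewrite !subrr.
exists psi; split=> //; last exact: inverse_hom hphi can1 can2 (can_inj hg) hr hs.
split=> // k W hW.
(* The inverse is continuous because the range maps are local homeomorphisms
   and [phi] lies over the homeomorphism [h]. *)
have [N hN iN] := arng_locally_inj k.
have hW' : nbhs (psi k) (W `&` phi @^-1` N).
  by apply: filterI => //; apply: phic; rewrite can2.
have := arng_open hW'.
have -> : arng (psi k) = g (arng k) by rewrite -[in RHS](can2 k) hr hg.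
move=> /gc/arng_continuous hW''.
apply: (@filterS2 _ (nbhs k) _ _ _ _ _ hW'' hN) => k' [j [Wj Nj] ej] Nk'.
suff -> : k' = phi j by rewrite /= can1.
apply: iN; rewrite ?inE //.
by rewrite hr ej gh.
Qed.

Theorem theorem4p2 (E F : digraph) :
  [/\ forall phi : groupoid E -> groupoid F, groupoid_iso phi ->
        exists h : bpath E -> bpath F,
          [/\ unique (induces phi) h, orbit_equivalence h &
              preserves_isolated_eventually_periodic h],
      forall h : bpath E -> bpath F,
        orbit_equivalence h -> preserves_isolated_eventually_periodic h ->
        exists phi : groupoid E -> groupoid F,
          groupoid_iso phi /\ induces phi h
    & (exists phi : groupoid E -> groupoid F, groupoid_iso phi) <->
      (exists h : bpath E -> bpath F,
         orbit_equivalence h /\ preserves_isolated_eventually_periodic h)].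
Proof.
split.
- by move=> phi /iso_orbit_equivalence h; exists (induced_map phi).
- exact: orbit_equivalence_iso.
- split=> [[phi /iso_orbit_equivalence[_ h1 h2]]|[h [h1 h2]]].
    by exists (induced_map phi).
  by have [phi []] := orbit_equivalence_iso h1 h2; exists phi.
Qed.
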